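(* Assume that the partition $\mathcal T_h$ of $(0,T)$ satisfies $$\frac{Lk_n}{2}\sqrt{8+k_n^2}<1,\qquad 1\le n\le N.$$ Then the discrete problem: find $U\in S^{\mathbf r,2}(\mathcal T_h)$ such that $U(0)=u_0$, $U'(0)=u_1$ and $$\sum_{n=1}^N\int_{I_n}U''(t)\varphi(t)\,dt=\sum_{n=1}^N\int_{I_n}f(t,U(t),U'(t))\varphi(t)\,dt\qquad\forall\varphi\in S^{\mathbf r-2,0}(\mathcal T_h),$$ admits a unique solution $U\in S^{\mathbf r,2}(\mathcal T_h)$.
   Context: $T>0$, $I=(0,T)$, $u_0,u_1\in\mathbb R$, and $f:\bar I\times\mathbb R\times\mathbb R\to\mathbb R$ is continuous for $t\in\bar I$ and satisfies the uniform Lipschitz condition $|f(t,u_1,v_1)-f(t,u_2,v_2)|\le L(|u_1-u_2|+|v_1-v_2|)$ for all $u_i,v_i\in\mathbb R$ and $t\in\bar I$, with $L>0$ independent of $t$. The partition $\mathcal T_h=\{I_n\}_{n=1}^N$ consists of subintervals $I_n=(t_{n-1},t_n)$, $0=t_0<t_1<\dots<t_N=T$, with $k_n=t_n-t_{n-1}$. Each $I_n$ is assigned an integer degree $r_n\ge2$; $\mathbf r=\{r_n\}_{n=1}^N$. $P_m(I_n)$ is the space of polynomials of degree at most $m$ on $I_n$, $S^{\mathbf r,2}(\mathcal T_h)=\{v\in H^2(I): v|_{I_n}\in P_{r_n}(I_n),1\le n\le N\}$ and $S^{\mathbf r-2,0}(\mathcal T_h)=\{v\in L^2(I): v|_{I_n}\in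 P_{r_n-2}(I_n),1\le n\le N\}$. *)

(* Defs.v *)
From HB Require Import structures.
From mathcomp Require Import all_boot all_order all_algebra.
From mathcomp Require Import all_classical all_reals all_analysis.

Set Implicit Arguments.
Unset Strict Implicit.
Unset Printing Implicit Defensive.

Import Order.TTheory GRing.Theory Num.Theory.
Import numFieldNormedType.Exports.

Local Open Scope classical_set_scope.
Local Open Scope ring_scope.

(* In this file a function on I = (0,T) is a total function R -> R whose values
   outside I (outside the closure of I, for continuous functions) carry no
   meaning; every definition below ignores them. *)

(* v \in L^2(I): the extension of v by zero is square integrable on R. *)
Definition L2 (R : realType) (T : R) (v : R -> R) : Prop :=
  v \_ `]0, T[ \in Lfun (@lebesgue_measure R) 2%:E.

(* C^1 functions with compact support in I: testing weak derivatives of L^2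
   functions against these or against C^oo_c(I) is the same, by density. *)
Definition C1c (R : realType) (T : R) (phi : R -> R) : Prop :=
  [/\ forall x, derivable phi x 1,
      continuous (derive1 phi) &
      exists2 K : set R, compact K /\ K `<=` `]0, T[ &
        forall x, ~ K x -> phi x = 0].

Definition weak_derivative (R : realType) (T : R) (v g : R -> R) : Prop :=
  forall phi, C1c T phi ->
    \int[@lebesgue_measure R]_(x in `]0, T[) (v x * derive1 phi x)
    = - \int[@lebesgue_measure R]_(x in `]0, T[) (g x * phi x).

(* The Sobolev space H^m(I) = W^{m,2}(I); H^0 = L^2. *)
Fixpoint Sobolev (R : realType) (T : R) (m : nat) (v : R -> R) : Prop :=
  if m is m'.+1 then
    L2 T v /\ exists2 g, weak_derivative T v g & Sobolev T m' g
  else L2 T v.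

(* Only t 0, ..., t N are used; the n-th subinterval is (t n.-1, t n). *)
Definition is_partition (R : realType) (T : R) (N : nat) (t : nat -> R) : Prop :=
  [/\ t 0%N = 0, t N = T & forall n, (1 <= n <= N)%N -> t n.-1 < t n].

Definition step (R : realType) (t : nat -> R) (n : nat) : R := t n - t n.-1.

Definition subitv (R : realType) (t : nat -> R) (n : nat) : set R :=
  `]t n.-1, t n[.

(* The space S^{r,m}: members of H^m(I) whose restriction to the n-th
   subinterval is a polynomial of degree at most r n, for 1 <= n <= N. *)
Definition spline_space (R : realType) (T : R) (N : nat) (t : nat -> R)
    (r : nat -> nat) (m : nat) (v : R -> R) : Prop :=
  Sobolev T m v /\
  forall n, (1 <= n <= N)%N ->
    exists2 p : {poly R}, (size p <= (r n).+1)%N &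
      forall x, subitv t n x -> v x = p.[x].

(* An element of H^2(I) is represented by its continuous representative on
   [0,T], which gives a meaning to U(0); as H^2(I) embeds in C^1([0,T]), U'(0)
   is the one-sided derivative. On each open subinterval U is a polynomial, so
   U' and U'' under the integrals are classical derivatives. *)
Definition discrete_solution (R : realType) (T : R) (N : nat) (t : nat -> R)
    (r : nat -> nat) (f : R -> R -> R -> R) (u0 u1 : R) (U : R -> R) : Prop :=
  [/\ spline_space T N t r 2 U /\ {within `[0, T], continuous U},
      U 0 = u0,
      (fun h : R => h^-1 * (U h - U 0)) @ 0^'+ --> u1 &
      forall phi, spline_space T N t (fun n => (r n - 2)%N) 0 phi ->
        \sum_(1 <= n < N.+1)
          \int[@lebesgue_measure R]_(s in subitv t n) (derive1n 2 U s * phi s)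
        = \sum_(1 <= n < N.+1)
          \int[@lebesgue_measure R]_(s in subitv t n)
            (f s (U s) (derive1 U s) * phi s)].

(* Main.v *)
(* On one subinterval put w = U''. As U and U' at the left node are known, the
   discrete equations say that w is the L^2-projection onto P_{r-2} of
   f(., U, U'), where U and U' are recovered from w by integrating. If two
   candidates agree to first order at the left node and differ by d, then
   ||d'||^2 <= k^2/2 ||d''||^2 and ||d||^2 <= k^4/8 ||d''||^2 by Cauchy-Schwarz,
   so w |-> projection is Lipschitz in L^2 with constant at most
   L (k^2 + k^4/4)^(1/2) <= (L k / 2) (8 + k^2)^(1/2) < 1, and it has exactly one
   fixed point. The pieces are then glued from left to right into a C^1 spline,
   which lies in H^2. Conversely a member of H^2 that is piecewise polynomial has
   no jump in its derivative at a node a: tested against a C^2 bump of height 1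
   and width e at a, such a jump equals the integral of an L^2 function times
   the bump, which is O(e^(1/2)). So every discrete solution solves the same
   local problems with the same initial data. *)
Require Import Defs.
From HB Require Import structures.
From mathcomp Require Import all_boot all_order all_algebra.
From mathcomp Require Import all_classical all_reals all_analysis.
From mathcomp Require Import measurable_realfun ring lra.

Import Order.TTheory GRing.Theory Num.Theory.
Import numFieldNormedType.Exports.

Local Open Scope classical_set_scope.
Local Open Scope ring_scope.

(** * Integrals of continuous functions over segments *)

Section integral_continuous.
Context {R : realType}.
Notation mu := (@lebesgue_measure R).
Implicit Types (f g F : R -> R) (p q : {poly R}) (a b c : R).

Lemma continuous_integrable f a b : continuous f ->
  mu.-integrable `[a, b] (EFin \o f).
Proof.
move=> cf; apply: continuous_compact_integrable; first exact: segment_compact.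
exact: continuous_subspaceT.
Qed.

Lemma continuous_bounded_segment f a b : continuous f ->
  exists M, forall x, a <= x <= b -> `|f x| <= M.
Proof.
move=> cf; have : bounded_set (f @` `[a, b]).
  apply: compact_bounded; apply: continuous_compact; last exact: segment_compact.
  exact: continuous_subspaceT.
move=> [M [_ hM]]; exists (M + 1) => x axb.
by apply: (hM (M + 1)); [rewrite ltrDl|exists x => //=; rewrite in_itv].
Qed.

Lemma Rintegral_FTC2 F f a b : a <= b -> continuous f ->
  (forall x : R, is_derive x (1 : R) F (f x)) ->
  \int[mu]_(x in `[a, b]) f x = F b - F a.
Proof.
rewrite le_eqVlt => /predU1P[<- _ _|ab cf dF].
  by rewrite subrr set_itv1 Rintegral_set1.
have cF x : {for x, continuous F}.
  by apply/differentiable_continuous/derivable1_diffP; case: (dF x).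
rewrite /Rintegral (@continuous_FTC2 _ f F a b)//.
- exact: continuous_subspaceT.
- split.
  + by move=> x _; case: (dF x).
  + exact/cvg_at_right_filter/cF.
  + exact/cvg_at_left_filter/cF.
- by move=> x _; rewrite derive1E; case: (dF x).
Qed.

Lemma continuousMr f g : continuous f -> continuous g ->
  continuous (fun x => f x * g x).
Proof. by move=> cf cg x; apply: continuousM; [exact: cf|exact: cg]. Qed.

Lemma continuousDr f g : continuous f -> continuous g ->
  continuous (fun x => f x + g x).
Proof. by move=> cf cg x; apply: continuousD; [exact: cf|exact: cg]. Qed.

Lemma continuousBr f g : continuous f -> continuous g ->
  continuous (fun x => f x - g x).
Proof. by move=> cf cg x; apply: continuousB; [exact: cf|exact: cg]. Qed.

Lemma continuous_sqr f : continuous f -> continuous (fun x => f x ^+ 2).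
Proof. move=> cf; exact: continuousMr. Qed.

Lemma continuous_sumr (I : Type) (s : seq I) (h : I -> R -> R) :
  (forall i, continuous (h i)) -> continuous (fun x => \sum_(i <- s) h i x).
Proof.
move=> ch; elim: s => [|i s ih] x.
  by under eq_fun do rewrite big_nil; exact: cvg_cst.
under eq_fun do rewrite big_cons.
exact: continuousDr.
Qed.

Lemma continuous_scaler c f : continuous f -> continuous (fun x => c * f x).
Proof. by move=> cf; apply: continuousMr => //; exact: cst_continuous. Qed.

Lemma RintegralD_cont f g a b : continuous f -> continuous g ->
  \int[mu]_(x in `[a, b]) (f x + g x) =
  \int[mu]_(x in `[a, b]) f x + \int[mu]_(x in `[a, b]) g x.
Proof. by move=> cf cg; rewrite RintegralD//; exact: continuous_integrable. Qed.

Lemma RintegralB_cont f g a b : continuous f -> continuous g ->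
  \int[mu]_(x in `[a, b]) (f x - g x) =
  \int[mu]_(x in `[a, b]) f x - \int[mu]_(x in `[a, b]) g x.
Proof. by move=> cf cg; rewrite RintegralB//; exact: continuous_integrable. Qed.

Lemma RintegralZl_cont c f a b : continuous f ->
  \int[mu]_(x in `[a, b]) (c * f x) = c * \int[mu]_(x in `[a, b]) f x.
Proof. by move=> cf; rewrite RintegralZl//; exact: continuous_integrable. Qed.

Lemma Rintegral_sum_cont (I : Type) (s : seq I) (h : I -> R -> R) a b :
  (forall i, continuous (h i)) ->
  \int[mu]_(x in `[a, b]) (\sum_(i <- s) h i x) =
  \sum_(i <- s) \int[mu]_(x in `[a, b]) h i x.
Proof.
move=> ch; elim: s => [|i s ih].
  under eq_Rintegral do rewrite big_nil.
  by rewrite big_nil Rintegral_cst// mul0r.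
under eq_Rintegral do rewrite big_cons.
by rewrite RintegralD_cont ?big_cons ?ih//; exact: continuous_sumr.
Qed.

Lemma le_Rintegral_cont f g a b : continuous f -> continuous g ->
  (forall x, a <= x <= b -> f x <= g x) ->
  \int[mu]_(x in `[a, b]) f x <= \int[mu]_(x in `[a, b]) g x.
Proof.
move=> cf cg fg; apply: le_Rintegral => //; try exact: continuous_integrable.
Qed.

Lemma Rintegral_sqr_ge0 f a b : 0 <= \int[mu]_(x in `[a, b]) (f x ^+ 2).
Proof. by apply: Rintegral_ge0 => x _; exact: sqr_ge0. Qed.

(** The integral of [(f - c * g) ^+ 2] is a nonnegative quadratic in [c]; its value at the minimizer
    [B / C] gives the inequality. *)
Lemma cauchy_schwarz_Rintegral f g a b : continuous f -> continuous g ->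
  (\int[mu]_(x in `[a, b]) (f x * g x)) ^+ 2 <=
  \int[mu]_(x in `[a, b]) (f x ^+ 2) * \int[mu]_(x in `[a, b]) (g x ^+ 2).
Proof.
move=> cf cg.
set A := \int[mu]_(x in _) (f x ^+ 2); set C := \int[mu]_(x in _) (g x ^+ 2).
set B := \int[mu]_(x in _) (f x * g x).
have key c : 0 <= A - 2 * c * B + c ^+ 2 * C.
  have := Rintegral_sqr_ge0 (fun x => f x - c * g x) a b.
  suff -> : \int[mu]_(x in `[a, b]) ((f x - c * g x) ^+ 2) =
      A - 2 * c * B + c ^+ 2 * C by [].
  under eq_Rintegral => x _.
    rewrite (_ : _ ^+ 2 = f x ^+ 2 - 2 * c * (f x * g x) + c ^+ 2 * g x ^+ 2);
      last by ring.
    over.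
  have cf2 := @continuous_sqr f cf; have cg2 := @continuous_sqr g cg.
  have cfg := continuousMr _ _ cf cg.
  rewrite RintegralD_cont; last 2 first.
  - by apply: continuousBr => //; exact: continuous_scaler.
  - exact: continuous_scaler.
  by rewrite RintegralB_cont ?RintegralZl_cont//; exact: continuous_scaler.
have A0 : 0 <= A by exact: Rintegral_sqr_ge0.
have C0 : 0 <= C by exact: Rintegral_sqr_ge0.
have [C_gt0|] := ltP 0 C; last first.
  move=> Cle0; have C00 : C = 0 by apply/eqP; rewrite eq_le Cle0 C0.
  have [->|B0] := eqVneq B 0; first by rewrite C00 expr0n/= mulr0.
  (* With [C = 0] the quadratic is affine in [c]; this [c] would give it the value -1 if [B] were
     nonzero. *)
  have := key ((A + 1) / (2 * B)); rewrite C00.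
  have -> : A - 2 * ((A + 1) / (2 * B)) * B + ((A + 1) / (2 * B)) ^+ 2 * 0 = -1.
    by field.
  by rewrite lerNr oppr0 ler10.
have := key (B / C).
have -> : A - 2 * (B / C) * B + (B / C) ^+ 2 * C = (A * C - B ^+ 2) / C.
  by field; rewrite gt_eqF.
by rewrite pmulr_lge0 ?invr_gt0// subr_ge0.
Qed.

Lemma poly_itv_eq0 p a b : a < b -> (forall x, a < x < b -> p.[x] = 0) ->
  p = 0.
Proof.
move=> ab p0; apply/eqP/negPn/negP => pn0.
(* As many distinct roots as the size of [p]; denominators start at 2 to stay strictly below [b]. *)
pose s := [seq a + (b - a) / i.+2%:R | i <- iota 0 (size p)].
suff : (size s < size p)%N by rewrite size_map size_iota ltnn.
apply: max_poly_roots => //.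
  apply/allP => _ /mapP[i _ ->]; apply/rootP/p0.
  have i2 : (1 : R) < i.+2%:R by rewrite ltr1n.
  have i0 : (0 : R) < i.+2%:R by rewrite ltr0n.
  rewrite ltrDl divr_gt0 ?subr_gt0//= -ltrBrDl ltr_pdivrMr//.
  by rewrite ltr_pMr ?subr_gt0.
rewrite map_inj_uniq ?iota_uniq// => i j /addrI /mulfI.
by rewrite subr_eq0 gt_eqF// => /(_ isT)/invr_inj/eqP; rewrite eqr_nat => /eqP[].
Qed.

(** The constant term is a division by zero, hence 0. *)
Definition antideriv p : {poly R} := \poly_(i < (size p).+1) (p`_i.-1 / i%:R).

Lemma antiderivK p : (antideriv p)^`() = p.
Proof.
apply/polyP => i; rewrite coef_deriv coef_poly ltnS /=.
have [ip|pi] := ltnP i (size p); last by rewrite mul0rn nth_default.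
by rewrite -[_ *+ i.+1]mulr_natr divfK// pnatr_eq0.
Qed.

Lemma size_antideriv p : (size (antideriv p) <= (size p).+1)%N.
Proof. exact: size_poly. Qed.

Lemma Rintegral_deriv p a b : a <= b ->
  \int[mu]_(x in `[a, b]) p^`().[x] = p.[b] - p.[a].
Proof. by move=> ab; apply: Rintegral_FTC2 => //; exact: continuous_horner. Qed.

Lemma Rintegral_sqr_horner p a b : a <= b ->
  \int[mu]_(x in `[a, b]) (p.[x] ^+ 2) =
  (antideriv (p ^+ 2)).[b] - (antideriv (p ^+ 2)).[a].
Proof.
move=> ab; rewrite -Rintegral_deriv// antiderivK.
by apply: eq_Rintegral => x _; rewrite horner_exp.
Qed.

(** An antiderivative of [p ^+ 2] is nondecreasing and takes equal values at [a] and [b], so it is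
    constant on the segment, hence constant as a polynomial; its derivative [p ^+ 2] is then 0. *)
Lemma Rintegral_sqr_poly_eq0 p a b : a < b ->
  \int[mu]_(x in `[a, b]) (p.[x] ^+ 2) = 0 -> p = 0.
Proof.
move=> ab I0; pose F := antideriv (p ^+ 2).
have Fc : F - F.[a]%:P = 0.
  apply: (poly_itv_eq0 _ _ _ ab) => x /andP[/ltW ax /ltW xb].
  have := Rintegral_sqr_ge0 (horner p) a x; have := Rintegral_sqr_ge0 (horner p) x b.
  rewrite !Rintegral_sqr_horner// -/F hornerD hornerN hornerC => xbF axF.
  by have := Rintegral_sqr_horner p _ _ (ltW ab); rewrite I0 -/F; lra.
have : F^`() = 0 by rewrite (subr0_eq Fc) derivC.
by rewrite antiderivK => /eqP; rewrite expf_eq0/= => /eqP.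
Qed.

End integral_continuous.

(** * The problem on one subinterval *)

Section orthonormal_polynomials.
Context {R : realType} (a b : R).
Hypothesis ab : a < b.
Notation mu := (@lebesgue_measure R).
Implicit Types (p q : {poly R}).

Definition polydot p q : R := \int[mu]_(x in `[a, b]) (p.[x] * q.[x]).

Lemma polydotC p q : polydot p q = polydot q p.
Proof. by apply: eq_Rintegral => x _; rewrite mulrC. Qed.

Lemma polydotDl p1 p2 q : polydot (p1 + p2) q = polydot p1 q + polydot p2 q.
Proof.
rewrite /polydot -RintegralD_cont; last 2 first.
- by apply: continuousMr; exact: continuous_horner.
- by apply: continuousMr; exact: continuous_horner.
by apply: eq_Rintegral => x _; rewrite hornerD mulrDl.
Qed.

Lemma polydotZl c p q : polydot (c *: p) q = c * polydot p q.
Proof.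
rewrite /polydot -RintegralZl_cont; last first.
  by apply: continuousMr; exact: continuous_horner.
by apply: eq_Rintegral => x _; rewrite hornerZ mulrA.
Qed.

Lemma polydotBl p1 p2 q : polydot (p1 - p2) q = polydot p1 q - polydot p2 q.
Proof. by rewrite polydotDl -scaleN1r polydotZl mulN1r. Qed.

Lemma polydot_suml (I : Type) (s : seq I) (F : I -> {poly R}) q :
  polydot (\sum_(i <- s) F i) q = \sum_(i <- s) polydot (F i) q.
Proof.
elim: s => [|i s ih]; last by rewrite !big_cons polydotDl ih.
by rewrite !big_nil -[X in polydot X _](scale0r (0 : {poly R})) polydotZl mul0r.
Qed.

Lemma polydot_gt0 p : p != 0 -> 0 < polydot p p.
Proof.
move=> p0; rewrite lt_neqAle Rintegral_ge0 ?andbT; last first.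
  by move=> x _; rewrite -expr2 sqr_ge0.
apply: contra_neq p0 => I0; apply: (@Rintegral_sqr_poly_eq0 _ _ a b) => //.
Qed.

(** Gram-Schmidt on the monomials: each step normalizes ['X^m] minus its projection on the elements
    already built. *)
Lemma orthonormal_poly_basis m : exists e : nat -> {poly R},
  [/\ forall i j, (i < m)%N -> (j < m)%N -> polydot (e i) (e j) = (i == j)%:R,
      forall i, (i < m)%N -> (size (e i) <= m)%N &
      forall p, (size p <= m)%N -> exists c : nat -> R,
        p = \sum_(i < m) c i *: e i].
Proof.
elim: m => [|m [e [eo es ep]]].
  exists (fun=> 0); split => // p; rewrite leqn0 size_poly_eq0 => /eqP ->.
  by exists (fun=> 0); rewrite big_ord0.
pose r := \sum_(i < m) polydot 'X^m (e i) *: e i.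
have szr : (size r <= m)%N.
  apply: (leq_trans (size_sum _ _ _)); apply/bigmax_leqP => i _.
  by rewrite (leq_trans (size_scale_leq _ _))// es.
pose q := 'X^m - r.
have szq : size q = m.+1 by rewrite size_polyDl size_polyXn// size_polyN ltnS.
have q0 : q != 0 by rewrite -size_poly_gt0 szq.
have qm : q`_m = 1 by rewrite coefB coefXn eqxx (nth_default _ szr) subr0.
have qe j : (j < m)%N -> polydot q (e j) = 0.
  move=> jm; rewrite polydotBl polydot_suml (bigD1 (Ordinal jm))//=.
  rewrite polydotZl eo// eqxx mulr1 big1 ?addr0 ?subrr// => i ij.
  by rewrite polydotZl eo// (negbTE (ij : (i : nat) != j)) mulr0.
pose n := Num.sqrt (polydot q q).
have n0 : n != 0 by rewrite gt_eqF// sqrtr_gt0 polydot_gt0.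
have nn : n * n = polydot q q by rewrite -expr2 sqr_sqrtr// ltW// polydot_gt0.
pose e' i := if i == m then n^-1 *: q else e i.
exists e'; split.
- move=> i j; rewrite !ltnS /e' => im jm.
  have [iM|inm] := eqVneq i m; have [jM|jnm] := eqVneq j m.
  + by rewrite iM jM eqxx polydotZl polydotC polydotZl -nn mulKf // mulVf.
  + by rewrite polydotZl qe ?mulr0 ?ltn_neqAle ?jnm// iM eq_sym (negbTE jnm).
  + by rewrite polydotC polydotZl qe ?mulr0 ?ltn_neqAle ?inm// jM (negbTE inm).
  + by rewrite eo// ltn_neqAle ?inm ?jnm.
- move=> i; rewrite ltnS /e' => im; have [_|inm] := eqVneq i m.
    by rewrite (leq_trans (size_scale_leq _ _))// szq.
  by rewrite (leq_trans (es _ _))// ltn_neqAle inm.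
(* Since [q] has size [m.+1] and leading coefficient 1, this subtraction removes the top coefficient
   and the induction hypothesis applies. *)
- move=> p szp; have [|c pc] := ep (p - p`_m *: q).
    apply/leq_sizeP => j; rewrite leq_eqVlt => /predU1P[<-|mj].
      by rewrite coefB coefZ qm mulr1 subrr.
    by rewrite coefB coefZ (nth_default 0 (leq_trans szp mj)) [q`_j]nth_default
      ?szq// mulr0 subrr.
  exists (fun i => if i == m then p`_m * n else c i).
  rewrite big_ord_recr/= /e' eqxx scalerA mulfK//.
  rewrite -[LHS](subrK (p`_m *: q)) pc; congr (_ + _); apply: eq_bigr => i _.
  by rewrite ltn_eqF.
Qed.

Lemma polydot_ortho (e : nat -> {poly R}) m (c : nat -> R) :
  (forall i j, (i < m)%N -> (j < m)%N -> polydot (e i) (e j) = (i == j)%:R) ->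
  \int[mu]_(x in `[a, b]) ((\sum_(i < m) c i *: e i).[x] ^+ 2) =
  \sum_(i < m) c i ^+ 2.
Proof.
move=> eo.
transitivity (polydot (\sum_(i < m) c i *: e i) (\sum_(i < m) c i *: e i)).
  by apply: eq_Rintegral => x _; rewrite expr2.
rewrite polydot_suml; apply: eq_bigr => i _.
rewrite polydotZl polydotC polydot_suml (bigD1 i)//= polydotZl eo// eqxx mulr1.
by rewrite big1 ?addr0// => j ji; rewrite polydotZl eo// (negbTE (ji : (j : nat) != i)) mulr0.
Qed.

(** Let [w] be the projection of [h]. Both the integral of [h * w] and that of [w ^+ 2] equal the
    left-hand sum, so the claim is the nonnegativity of the integral of [(h - w) ^+ 2]. *)
Lemma bessel (e : nat -> {poly R}) m (h : R -> R) : continuous h ->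
  (forall i j, (i < m)%N -> (j < m)%N -> polydot (e i) (e j) = (i == j)%:R) ->
  \sum_(i < m) (\int[mu]_(x in `[a, b]) (h x * (e i).[x])) ^+ 2 <=
  \int[mu]_(x in `[a, b]) (h x ^+ 2).
Proof.
move=> ch eo; pose c i := \int[mu]_(x in `[a, b]) (h x * (e i).[x]).
pose w := \sum_(i < m) c i *: e i.
have cw := @continuous_horner _ w.
have hw : \int[mu]_(x in `[a, b]) (h x * w.[x]) = \sum_(i < m) c i ^+ 2.
  under eq_Rintegral do rewrite horner_sum mulr_sumr.
  have ce i : continuous (fun x => h x * (e i).[x]).
    by apply: continuousMr => //; exact: continuous_horner.
  under eq_Rintegral => x _.
    under eq_bigr do rewrite hornerZ mulrCA.
    over.
  rewrite Rintegral_sum_cont; last by move=> i; exact: continuous_scaler.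
  by apply: eq_bigr => i _; rewrite RintegralZl_cont// expr2.
have := Rintegral_sqr_ge0 (fun x => h x - w.[x]) a b.
under eq_Rintegral => x _.
  rewrite (_ : _ ^+ 2 = h x ^+ 2 - 2 * (h x * w.[x]) + w.[x] ^+ 2); last by ring.
  over.
have ch2 := @continuous_sqr _ _ ch; have cw2 := @continuous_sqr _ _ cw.
have chw := @continuousMr _ _ _ ch cw.
rewrite RintegralD_cont//; last first.
  by apply: continuousBr => //; exact: continuous_scaler.
rewrite RintegralB_cont//; last exact: continuous_scaler.
rewrite RintegralZl_cont// hw polydot_ortho// /c; lra.
Qed.

End orthonormal_polynomials.

(** Equips nonempty matrices with the structure of a complete normed space, over which Banach's
    theorem is stated. *)
HB.instance Definition _ (R : realType) (m n : nat) :=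
  Complete.on 'M[R]_(m.+1, n.+1).

(** * Fixed points of Euclidean contractions *)

Section finite_dimensional_contraction.
Context {R : realType} (m : nat).
Implicit Types (x y : 'rV[R]_m.+1) (F : 'rV[R]_m.+1 -> 'rV[R]_m.+1).

(** The squared Euclidean norm. For coordinates in an orthonormal family it is the squared $L^2$
    norm, the one in which the projection map contracts. *)
Definition sumsq x : R := \sum_i x ord0 i ^+ 2.

Lemma sqr_norm_le_sumsq x : `|x| ^+ 2 <= sumsq x.
Proof.
have [->|x0] := eqVneq x 0.
  by rewrite normr0 expr0n sumr_ge0// => i _; exact: sqr_ge0.
have [[i j]] : exists ij, mx_norm x = `|x ij.1 ij.2|.
  by apply: mx_norm_neq0; rewrite -[mx_norm x]/(`|x|) normr_eq0.
rewrite -[mx_norm x]/(`|x|) => ->; rewrite real_normK ?num_real//=.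
rewrite (ord1 i) /sumsq (bigD1 j)//= lerDl sumr_ge0// => k _; exact: sqr_ge0.
Qed.

Lemma sumsq_le_sqr_norm x : sumsq x <= m.+1%:R * `|x| ^+ 2.
Proof.
rewrite mulr_natl -[X in _ *+ X]card_ord -sumr_const; apply: ler_sum => i _.
rewrite -[leLHS]real_normK ?num_real// lerXn2r ?nnegrE//.
rewrite [leRHS]mx_normrE; exact: (le_bigmax _ (fun k => `|x k.1 k.2|) (ord0, i)).
Qed.

(* Banach's theorem is available for the sup norm of 'rV, for which only a high
   iterate of [F] is a contraction; [F] maps its unique fixed point to a fixed
   point. *)
Lemma sumsq_contraction_fixpoint F (kappa : R) : 0 <= kappa < 1 ->
  (forall x y, sumsq (F x - F y) <= kappa * sumsq (x - y)) ->
  exists x, F x = x.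
Proof.
move=> /andP[k0 k1] cF.
have cFj j x y : sumsq (iter j F x - iter j F y) <= kappa ^+ j * sumsq (x - y).
  elim: j => [|j ih]; first by rewrite expr0 mul1r.
  by rewrite !iterS exprS -mulrA (le_trans (cF _ _))// ler_wpM2l.
(* Passing from the sup norm to [sumsq] costs a factor [m.+1]; the remaining 1/4 is the square of
   the contraction constant 1/2 of the iterate. *)
have [j kj] : exists j, kappa ^+ j <= (4 * m.+1%:R)^-1.
  have : (fun n => kappa ^+ n) @ \oo --> 0 by apply: cvg_expr; rewrite ger0_norm.
  move=> /cvgrPdist_le /(_ (4 * m.+1%:R)^-1); case.
    by rewrite invr_gt0 mulr_gt0.
  move=> j _ /(_ j (leqnn j)); rewrite sub0r normrN ger0_norm ?exprn_ge0//.
  by exists j.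
pose G : {fun [set: 'rV[R]_m.+1] >-> [set: 'rV[R]_m.+1]} := totalfun (iter j F).
have ctrG : is_contraction G.
  exists 2^-1%:nng; split=> /=; first by rewrite invf_lt1// ltr1n.
  move=> [x y] _ /=.
  rewrite -(@ler_pXn2r _ 2)// ?nnegrE// ?mulr_ge0//.
  rewrite (le_trans (sqr_norm_le_sumsq _))// (le_trans (cFj _ _ _))//.
  rewrite (le_trans (ler_wpM2l _ (sumsq_le_sqr_norm _))) ?exprn_ge0//.
  rewrite exprMn mulrA ler_wpM2r ?sqr_ge0//.
  rewrite -ler_pdivlMr// (le_trans kj)// invfM exprVn -natrX.
  by [].
have [p _ pG] := @banach_fixed_point R _ setT G ctrG closedT (ex_intro _ 0 I).
exists p; apply: (contraction_fixpoint_unique ctrG) => //=.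
rewrite -[RHS]/(iter j F (F p)) -iterSr iterS.
by congr F.
Qed.

End finite_dimensional_contraction.

(** * Bounds by the second derivative *)

Section energy_estimate.
Context {R : realType}.
Notation mu := (@lebesgue_measure R).
Implicit Types (p w : {poly R}) (a b : R).

Lemma Rintegral_shift_exp a b n : a <= b ->
  \int[mu]_(x in `[a, b]) ((x - a) ^+ n) = (b - a) ^+ n.+1 / n.+1%:R.
Proof.
move=> ab; have n0 : n.+1%:R != 0 :> R by rewrite pnatr_eq0.
pose p : {poly R} := n.+1%:R^-1 *: ('X - a%:P) ^+ n.+1.
transitivity (\int[mu]_(x in `[a, b]) p^`().[x]).
  apply: eq_Rintegral => x _; rewrite derivZ deriv_exp derivB derivX derivC subr0 mul1r/=.
  rewrite hornerZ hornerMn horner_exp !hornerE.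
  by rewrite -[X in _ * X]mulr_natl mulKf.
by rewrite Rintegral_deriv// /p !hornerE subrr expr0n/= mulr0 subr0 mulrC.
Qed.

Lemma sqr_horner_le a b p x : a <= x <= b -> p.[a] = 0 ->
  p.[x] ^+ 2 <= (x - a) * \int[mu]_(s in `[a, x]) (p^`().[s] ^+ 2).
Proof.
move=> /andP[ax xb] pa0.
have := @cauchy_schwarz_Rintegral R (cst 1) (horner p^`()) a x
  (@cst_continuous _ _ _) (@continuous_horner _ _).
under eq_Rintegral do rewrite mul1r.
(* The integrand 1 is written as a zeroth power so that [Rintegral_shift_exp] computes the
   length. *)
under [X in _ <= X * _]eq_Rintegral => s _ do rewrite expr1n -(expr0 (s - a)).
by rewrite Rintegral_deriv// pa0 subr0 Rintegral_shift_exp// expr1 divr1.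
Qed.

Lemma le_Rintegral_sqr_segment p a b x : a <= x <= b ->
  \int[mu]_(s in `[a, x]) (p.[s] ^+ 2) <= \int[mu]_(s in `[a, b]) (p.[s] ^+ 2).
Proof.
move=> /andP[ax xb]; have ab := le_trans ax xb.
have := Rintegral_sqr_ge0 (horner p) x b.
by rewrite !Rintegral_sqr_horner//; lra.
Qed.

(* The weights k^2/2 and k^4/8 come from integrating (x-a) and (x-a)^3/2. *)
Lemma energy_estimate a b p : a <= b -> p.[a] = 0 -> p^`().[a] = 0 ->
  \int[mu]_(x in `[a, b]) (p.[x] ^+ 2 + p^`().[x] ^+ 2) <=
  ((b - a) ^+ 2 / 2 + (b - a) ^+ 4 / 8) *
    \int[mu]_(x in `[a, b]) (p^`()^`().[x] ^+ 2).
Proof.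
move=> ab pa p'a; set W := \int[mu]_(x in _) (p^`()^`().[x] ^+ 2).
have W0 : 0 <= W by exact: Rintegral_sqr_ge0.
have p'W x : a <= x <= b -> p^`().[x] ^+ 2 <= W * (x - a) ^+ 1.
  move=> /[dup] axb /andP[ax xb].
  rewrite (le_trans (sqr_horner_le _ _ _ _ axb p'a))// expr1 mulrC.
  by rewrite ler_wpM2r ?subr_ge0// le_Rintegral_sqr_segment.
have cshift n : continuous (fun x : R => (x - a) ^+ n).
  have -> : (fun x : R => (x - a) ^+ n) = horner (('X - a%:P) ^+ n).
    by apply/funext => x; rewrite !hornerE.
  exact: continuous_horner.
have cp q : continuous (fun x : R => q.[x] ^+ 2).
  by apply: continuous_sqr; exact: continuous_horner.
have pW x : a <= x <= b -> p.[x] ^+ 2 <= W / 2 * (x - a) ^+ 3.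
  move=> /[dup] axb /andP[ax xb].
  rewrite (le_trans (sqr_horner_le _ _ _ _ axb pa))//.
  have -> : W / 2 * (x - a) ^+ 3 = (x - a) * (W * ((x - a) ^+ 2 / 2)) by ring.
  rewrite ler_wpM2l ?subr_ge0// -Rintegral_shift_exp// -RintegralZl_cont//.
  apply: le_Rintegral_cont => // [|y /andP[ay yx]].
    exact: continuous_scaler.
  by rewrite p'W// ay (le_trans yx).
rewrite RintegralD_cont//.
have I1 : \int[mu]_(x in `[a, b]) (p^`().[x] ^+ 2) <= W * ((b - a) ^+ 2 / 2).
  rewrite -Rintegral_shift_exp// -RintegralZl_cont//.
  by apply: le_Rintegral_cont => //; exact: continuous_scaler.
have I2 : \int[mu]_(x in `[a, b]) (p.[x] ^+ 2) <= W / 2 * ((b - a) ^+ 4 / 4).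
  rewrite -Rintegral_shift_exp// -RintegralZl_cont//.
  by apply: le_Rintegral_cont => //; exact: continuous_scaler.
by lra.
Qed.

End energy_estimate.

(** * Existence and uniqueness for the local Galerkin equations *)

Section local_problem.
Context {R : realType} (a b L : R) (g : R -> R -> R -> R).
Hypotheses (ab : a < b) (L0 : 0 <= L).
Hypothesis cg : forall u v, continuous (fun s => g s u v).
Hypothesis lipg : forall s u1 v1 u2 v2,
  `|g s u1 v1 - g s u2 v2| <= L * (`|u1 - u2| + `|v1 - v2|).
Notation mu := (@lebesgue_measure R).
Let k := b - a.
(** This is $2L^2$ times the constant $k^2/2 + k^4/8$ of [energy_estimate]; the 2 comes from
    $(A+B)^2 \le 2(A^2+B^2)$. *)
Let kappa := L ^+ 2 * (k ^+ 2 + k ^+ 4 / 4).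
Hypothesis kappa1 : kappa < 1.
Implicit Types (p q w : {poly R}).

Definition rhs p (s : R) : R := g s p.[s] p^`().[s].

Lemma continuous_rhs p : continuous (rhs p).
Proof.
move=> x; apply/cvgrPdist_le => e e0.
(* [L + 1] in place of [L] keeps the divisor positive when [L = 0]; the 4 leaves [e / 2] for the two
   Lipschitz terms together. *)
have L1 : 0 < 4 * (L + 1) by rewrite mulr_gt0// ltr_wpDl.
have d0 : 0 < e / (4 * (L + 1)) by rewrite divr_gt0.
have e2 : 0 < e / 2 by rewrite divr_gt0.
near=> y.
have h1 : `|p.[x] - p.[y]| <= e / (4 * (L + 1)).
  by near: y; have /cvgrPdist_le := @continuous_horner R p x; exact.
have h2 : `|p^`().[x] - p^`().[y]| <= e / (4 * (L + 1)).
  by near: y; have /cvgrPdist_le := @continuous_horner R p^`() x; exact.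
have h3 : `|g x p.[x] p^`().[x] - g y p.[x] p^`().[x]| <= e / 2.
  by near: y; have /cvgrPdist_le := @cg p.[x] p^`().[x] x; exact.
rewrite /rhs (le_trans (ler_distD (g y p.[x] p^`().[x]) _ _))//.
have h4 : `|g y p.[x] p^`().[x] - g y p.[y] p^`().[y]| <= e / 2.
  rewrite (le_trans (lipg _ _ _ _ _))// (le_trans (ler_wpM2l L0 (lerD h1 h2)))//.
  have -> : L * (e / (4 * (L + 1)) + e / (4 * (L + 1))) = (e / 2) * (L / (L + 1)).
    by field; rewrite gt_eqF// ltr_wpDl.
  by rewrite -[leRHS]mulr1 (ler_wpM2l (ltW e2))// ler_pdivrMr ?ltr_wpDl// mul1r lerDl.
by rewrite (le_trans (lerD h3 h4))// -splitr.
Unshelve. all: end_near. Qed.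

(** The Lipschitz bound holds pointwise, and [energy_estimate] applies to [p - q], which vanishes at
    [a] with its derivative. *)
Lemma rhs_contraction p q : p.[a] = q.[a] -> p^`().[a] = q^`().[a] ->
  \int[mu]_(x in `[a, b]) ((rhs p x - rhs q x) ^+ 2) <=
  kappa * \int[mu]_(x in `[a, b]) ((p - q)^`()^`().[x] ^+ 2).
Proof.
move=> pqa pqa'.
have := @energy_estimate R a b (p - q) (ltW ab).
rewrite derivB 2!hornerD 2!hornerN pqa pqa' !subrr => /(_ erefl erefl) E.
have L20 : 0 <= 2 * L ^+ 2 by rewrite mulr_ge0// sqr_ge0.
rewrite (le_trans _ (le_trans (ler_wpM2l L20 E) _))//; last first.
  by rewrite mulrA ler_wpM2r ?Rintegral_sqr_ge0// /kappa -/k; lra.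
have cc : continuous (fun x : R => (p - q).[x] ^+ 2 + (p^`() - q^`()).[x] ^+ 2).
  by apply: continuousDr; apply: continuous_sqr; exact: continuous_horner.
rewrite -RintegralZl_cont//; apply: le_Rintegral_cont.
- by apply: continuous_sqr; apply: continuousBr; exact: continuous_rhs.
- exact: continuous_scaler.
move=> x _; rewrite !hornerD !hornerN.
rewrite -real_normK ?num_real//.
have := lipg x p.[x] p^`().[x] q.[x] q^`().[x].
rewrite -/(rhs p x) -/(rhs q x) => h.
rewrite (@le_trans _ _ ((L * (`|p.[x] - q.[x]| + `|p^`().[x] - q^`().[x]|)) ^+ 2))//.
  by rewrite lerXn2r// nnegrE// mulr_ge0// addr_ge0.
rewrite -[in leRHS](real_normK (num_real (p.[x] - q.[x]))).
rewrite -[in leRHS](real_normK (num_real (p^`().[x] - q^`().[x]))).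
rewrite -subr_ge0; set A := `|p.[x] - _|; set B := `|p^`().[x] - _|.
(* $2(A^2+B^2) - (A+B)^2 = (A-B)^2$. *)
rewrite (_ : _ - _ = (L * (A - B)) ^+ 2); first exact: sqr_ge0.
by ring.
Qed.

(** Integrates [w] twice from [a], with value [alpha] and slope [beta] there. *)
Definition lift_antideriv (alpha beta : R) w : {poly R} :=
  let v := beta%:P + (antideriv w - (antideriv w).[a]%:P) in
  alpha%:P + (antideriv v - (antideriv v).[a]%:P).

Lemma lift_antideriv_a alpha beta w : (lift_antideriv alpha beta w).[a] = alpha.
Proof. by rewrite /lift_antideriv !(hornerD, hornerN, hornerC) subrr addr0. Qed.

Lemma deriv_lift_antideriv alpha beta w : (lift_antideriv alpha beta w)^`() =
  beta%:P + (antideriv w - (antideriv w).[a]%:P).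
Proof.
by rewrite /lift_antideriv 2!derivD derivN !derivC oppr0 addr0 add0r antiderivK.
Qed.

Lemma deriv_lift_antideriv_a alpha beta w : (lift_antideriv alpha beta w)^`().[a] = beta.
Proof. by rewrite deriv_lift_antideriv !(hornerD, hornerN, hornerC) subrr addr0. Qed.

Lemma deriv2_lift_antideriv alpha beta w : (lift_antideriv alpha beta w)^`()^`() = w.
Proof.
by rewrite deriv_lift_antideriv 2!derivD derivN !derivC oppr0 addr0 add0r antiderivK.
Qed.

Lemma size_antideriv_shift (c : R) w n : (size w <= n)%N ->
  (size (c%:P + (antideriv w - (antideriv w).[a]%:P))%R <= n.+1)%N.
Proof.
move=> wn; rewrite (leq_trans (size_polyD _ _))// geq_max.
rewrite (leq_trans (size_polyC_leq1 _))//=.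
rewrite (leq_trans (size_polyD _ _))// geq_max size_polyN.
by rewrite (leq_trans (size_antideriv _))//= (leq_trans (size_polyC_leq1 _)).
Qed.

Lemma size_lift_antideriv alpha beta w n : (size w <= n)%N ->
  (size (lift_antideriv alpha beta w) <= n.+2)%N.
Proof. by move=> wn; do 2 apply: size_antideriv_shift. Qed.

(** Here [m] bounds sizes: test polynomials have degree less than [m]. *)
Definition galerkin m p := forall phi : {poly R}, (size phi <= m)%N ->
  \int[mu]_(s in `[a, b]) ((p^`()^`().[s] - rhs p s) * phi.[s]) = 0.

(** The unknown is the coordinate vector of the second derivative in an orthonormal basis. [F] sends
    it to the coordinates of the projected right-hand side; [bessel] and [rhs_contraction] make [F]
    a contraction for [sumsq], and its fixed point solves the equations. *)
Lemma galerkin_exists m alpha beta : exists p,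
  [/\ (size p <= m.+3)%N, p.[a] = alpha, p^`().[a] = beta & galerkin m.+1 p].
Proof.
have [e [eo es ep]] := orthonormal_poly_basis _ _ ab m.+1.
pose comb (x : 'rV[R]_m.+1) := \sum_(i < m.+1) x ord0 i *: e i.
pose P x := lift_antideriv alpha beta (comb x).
pose F (x : 'rV[R]_m.+1) : 'rV[R]_m.+1 :=
  \row_i \int[mu]_(s in `[a, b]) (rhs (P x) s * (e i).[s]).
(* [inord] turns the coordinates into a sequence over [nat], the form of coefficients in
   [polydot_ortho]. *)
have combB x y : comb x - comb y = \sum_(i < m.+1) (x - y) ord0 (inord i) *: e i.
  rewrite /comb -sumrB; apply: eq_bigr => i _.
  by rewrite -scalerBl !mxE inord_val.
have ce i : continuous (horner (e i)) by exact: continuous_horner.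
have [||x Fx] := @sumsq_contraction_fixpoint R m F kappa.
- rewrite kappa1 andbT mulr_ge0 ?sqr_ge0// addr_ge0 ?sqr_ge0//.
  by rewrite divr_ge0// exprn_even_ge0.
- move=> x y.
  have := @rhs_contraction (P x) (P y).
  rewrite !lift_antideriv_a !deriv_lift_antideriv_a => /(_ erefl erefl).
  rewrite 2!derivB !deriv2_lift_antideriv combB.
  rewrite (polydot_ortho a b e m.+1 (fun i => (x - y) ord0 (inord i))) //.
  have -> : \sum_(i < m.+1) (x - y) ord0 (inord i) ^+ 2 = sumsq m (x - y).
    by apply: eq_bigr => i _; rewrite inord_val.
  apply: le_trans; rewrite /sumsq.
  have cd : continuous (fun s => rhs (P x) s - rhs (P y) s).
    by apply: continuousBr; exact: continuous_rhs.
  apply: le_trans (bessel a b e m.+1 _ cd eo).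
  rewrite le_eqVlt; apply/orP; left; apply/eqP/eq_bigr => i _.
  rewrite !mxE -RintegralB_cont; last 2 first.
  - by apply: continuousMr => //; exact: continuous_rhs.
  - by apply: continuousMr => //; exact: continuous_rhs.
  by congr (_ ^+ 2); apply: eq_Rintegral => s _; rewrite mulrBl.
exists (P x); split.
- apply: size_lift_antideriv; apply: (leq_trans (size_sum _ _ _)).
  by apply/bigmax_leqP => i _; rewrite (leq_trans (size_scale_leq _ _))// es.
- exact: lift_antideriv_a.
- exact: deriv_lift_antideriv_a.
(* By linearity it is enough to test with basis elements, and for these the equation is the fixed
   point identity, coordinate by coordinate. *)
move=> phi /ep[c ->]; rewrite deriv2_lift_antideriv.
have cr : continuous (fun s => (comb x).[s] - rhs (P x) s).
  by apply: continuousBr; [exact: continuous_horner|exact: continuous_rhs].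
under eq_Rintegral => s _.
  rewrite [X in _ * X]horner_sum mulr_sumr.
  under eq_bigr do rewrite hornerZ mulrCA.
  over.
have crc i : continuous (fun s => ((comb x).[s] - rhs (P x) s) * (e i).[s]).
  exact: continuousMr.
rewrite Rintegral_sum_cont; last by move=> i; exact: continuous_scaler.
apply: big1 => i _; rewrite RintegralZl_cont//.
under eq_Rintegral do rewrite mulrBl.
rewrite RintegralB_cont; last 2 first.
- by apply: continuousMr => //; exact: continuous_horner.
- by apply: continuousMr => //; exact: continuous_rhs.
have -> : \int[mu]_(s in `[a, b]) (rhs (P x) s * (e i).[s]) = x ord0 i.
  by rewrite -[in RHS]Fx mxE.
rewrite -/(polydot a b (comb x) (e i)) polydot_suml (bigD1 i)//= polydotZl.
rewrite eo// eqxx mulr1 big1 ?addr0 ?subrr ?mulr0// => j ji.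
by rewrite polydotZl eo// (negbTE (ji : (j : nat) != i)) mulr0.
Qed.

Lemma deriv_eq0 p : p.[a] = 0 -> p^`() = 0 -> p = 0.
Proof.
move=> pa dp; apply: (poly_itv_eq0 _ _ _ ab) => x /andP[ax _].
rewrite -[LHS]subr0 -pa -Rintegral_deriv ?ltW// dp.
by under eq_Rintegral do rewrite horner0; rewrite Rintegral_cst// mul0r.
Qed.

(** The second derivative [w] of [p - q] is itself an admissible test polynomial. Testing the
    difference of the equations with it and applying Cauchy-Schwarz gives [W ^+ 2 <= kappa * W ^+ 2]
    for its squared norm [W], so [W = 0]. *)
Lemma galerkin_unique m p q : (size p <= m.+2)%N -> (size q <= m.+2)%N ->
  p.[a] = q.[a] -> p^`().[a] = q^`().[a] -> galerkin m p -> galerkin m q ->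
  p = q.
Proof.
move=> szp szq pqa pqa' gp gq.
set w := (p - q)^`()^`().
have szw : (size w <= m)%N.
  have sz1 n (r : {poly R}) : (size r <= n.+1)%N -> (size r^`() <= n)%N.
    move=> rn; apply/leq_sizeP => i ni; rewrite coef_deriv nth_default ?mul0rn//.
    exact: (leq_trans rn).
  by apply/sz1/sz1; rewrite (leq_trans (size_polyD _ _))// geq_max szp size_polyN.
have cw : continuous (horner w) by exact: continuous_horner.
have cr r : continuous (rhs r) by exact: continuous_rhs.
have cd : continuous (fun s => rhs p s - rhs q s) by exact: continuousBr.
set W := \int[mu]_(s in `[a, b]) (w.[s] ^+ 2).
have WE : W = \int[mu]_(s in `[a, b]) ((rhs p s - rhs q s) * w.[s]).
  apply/eqP; rewrite -subr_eq0 -[0](gp _ szw) -[X in _ == X]subr0 -(gq _ szw).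
  have cres (r : {poly R}) : continuous (fun s : R => (r^`()^`().[s] - rhs r s) * w.[s]).
    by apply: continuousMr => //; apply: continuousBr => //; exact: continuous_horner.
  rewrite -!RintegralB_cont//; last 2 first.
  - exact: continuous_sqr.
  - exact: continuousMr.
  apply/eqP/eq_Rintegral => s _.
  have -> : w.[s] = p^`()^`().[s] - q^`()^`().[s].
    by rewrite /w !derivB hornerD hornerN.
  by ring.
have CS := @cauchy_schwarz_Rintegral R _ _ a b cd cw.
have Rc := @rhs_contraction p q pqa pqa'.
have W0 : 0 <= W by exact: Rintegral_sqr_ge0.
have W00 : W = 0.
  apply/eqP; rewrite -sqrf_eq0 eq_le sqr_ge0 andbT.
  move: CS; rewrite -WE -/W => CS.
  have := le_trans CS (ler_wpM2r W0 Rc); rewrite -/w -/W -mulrA -expr2.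
  have := sqr_ge0 W; move: kappa1; move: (W ^+ 2) => X; nra.
have w0 : w = 0 by apply: (@Rintegral_sqr_poly_eq0 R w a b).
have pqa0 : (p - q).[a] = 0 by rewrite hornerD hornerN pqa subrr.
have pqa0' : (p - q)^`().[a] = 0 by rewrite derivB hornerD hornerN pqa' subrr.
apply/subr0_eq/(deriv_eq0 _ pqa0)/(deriv_eq0 _ pqa0'); exact: w0.
Qed.

End local_problem.

(** * Piecewise polynomials and their weak derivatives *)

Section gluing.
Context {R : realType}.
Implicit Types (f g : R -> R) (c : R).

Definition glue c f g : R -> R := fun x => if x <= c then f x else g x.

Lemma glue_near_lt c f g x : x < c -> \forall y \near x, glue c f g y = f y.
Proof.
move=> xc; near=> y; rewrite /glue ifT//; apply: ltW.
by near: y; exact: lt_nbhsl.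
Unshelve. all: end_near. Qed.

Lemma glue_near_gt c f g x : c < x -> \forall y \near x, glue c f g y = g y.
Proof.
move=> xc; near=> y; rewrite /glue ifF//; apply/negbTE; rewrite -ltNge.
by near: y; exact: lt_nbhsr.
Unshelve. all: end_near. Qed.

Lemma continuous_glue c f g : f c = g c -> continuous f -> continuous g ->
  continuous (glue c f g).
Proof.
move=> fg cf cg x.
have [xc|cx|->] := ltgtP x c.
- rewrite /continuous_at {2}/glue ltW//.
  apply: cvg_trans (cf x); apply: near_eq_cvg.
  by apply: filterS (glue_near_lt c f g x xc) => y ->.
- rewrite /continuous_at {2}/glue leNgt cx/=.
  apply: cvg_trans (cg x); apply: near_eq_cvg.
  by apply: filterS (glue_near_gt c f g x cx) => y ->.
- rewrite /continuous_at {2}/glue lexx; apply/cvgrPdist_le => e e0; near=> y.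
  rewrite /glue; case: ifP => _; first by near: y; have /cvgrPdist_le := cf c; exact.
  by rewrite fg; near: y; have /cvgrPdist_le := cg c; exact.
Unshelve. all: end_near. Qed.

(** At [c] every difference quotient of the glued function is one of [f] or one of [g], and both
    families have the same limit. *)
Lemma is_derive_glue c f g f' g' : f c = g c -> f' c = g' c ->
  (forall x : R, is_derive x (1 : R) f (f' x)) ->
  (forall x : R, is_derive x (1 : R) g (g' x)) ->
  forall x : R, is_derive x (1 : R) (glue c f g) (glue c f' g' x).
Proof.
move=> fg fg' df dg x.
have [xc|cx|->] := ltgtP x c.
- rewrite /glue ltW//; apply: (near_eq_is_derive _ (df x)).
  by apply: filterS (glue_near_lt c f g x xc) => y.
- rewrite {2}/glue leNgt cx/=; apply: (near_eq_is_derive _ (dg x)).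
  by apply: filterS (glue_near_gt c f g x cx) => y.
rewrite {2}/glue lexx.
have dcvg (h : R -> R) d : is_derive c (1 : R) h d ->
    (fun k : R => k^-1 *: (h (k *: (1 : R) + c) - h c)) @ 0^' --> d.
  by move=> [dh <-]; exact: dh.
have key : (fun k : R => k^-1 *: (glue c f g (k *: (1 : R) + c) - glue c f g c)) @ 0^' --> f' c.
  apply/cvgrPdist_le => e e0; near=> k.
  rewrite {2}/glue lexx {1}/glue; case: ifP => _.
    by near: k; have /cvgrPdist_le := dcvg _ _ (df c); exact.
  by rewrite fg fg'; near: k; have /cvgrPdist_le := dcvg _ _ (dg c); exact.
apply: DeriveDef; first by apply/cvg_ex; exists (f' c).
exact: cvg_lim.
Unshelve. all: end_near. Qed.

Lemma measurable_glue c f g : measurable_fun setT f -> measurable_fun setT g ->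
  measurable_fun setT (glue c f g).
Proof.
move=> mf mg; apply: measurable_fun_ifT => //.
exact: measurable_fun_ler.
Qed.

End gluing.

Section piecewise_polynomials.
Context {R : realType} (t : nat -> R).
Implicit Types (q : nat -> {poly R}) (n : nat).

(* [pw q n] is [q 0] up to [t 0], [q i] on [(t i.-1, t i]] for [0 < i < n], and
   [q n] to the right of [t n.-1]. *)
Fixpoint pw q n : R -> R :=
  if n is n'.+1 then glue (t n') (pw q n') (horner (q n)) else horner (q 0%N).

Variable N : nat.
Hypothesis t_incr : forall n, (1 <= n <= N)%N -> t n.-1 < t n.

Lemma t_le n m : (n <= m <= N)%N -> t n <= t m.
Proof.
elim: m => [|m ih]; first by rewrite leqn0 => /andP[/eqP -> _].
move=> /andP[+ mN]; rewrite leq_eqVlt => /predU1P[->//|nm].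
rewrite (le_trans (ih _))//; first by rewrite -ltnS nm ltnW.
by rewrite ltW// (t_incr m.+1)// mN.
Qed.

Lemma pw_node q n : (n <= N)%N -> pw q n (t n) = (q n).[t n].
Proof.
case: n => [//|n] nN /=; rewrite /glue ifF//.
by apply/negbTE; rewrite -ltNge (t_incr n.+1).
Qed.

Lemma pwE q n m x : (0 < n <= m)%N -> (m <= N)%N -> t n.-1 < x <= t n ->
  pw q m x = (q n).[x].
Proof.
elim: m => [|m ih]; first by rewrite leqn0 => /andP[/gtn_eqF ->].
move=> /andP[n0]; rewrite leq_eqVlt => /predU1P[nm|nm] mN /andP[nx xn].
  by move: nx xn; rewrite nm /= /glue => mx _; rewrite leNgt mx.
rewrite /= /glue ifT; first by apply: ih; rewrite ?n0 ?nx// ltnW.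
by rewrite (le_trans xn)// t_le// -ltnS nm ltnW.
Qed.

Lemma pw_le0 q m x : (m <= N)%N -> x <= t 0%N -> pw q m x = (q 0%N).[x].
Proof.
elim: m => [//|m ih] mN x0 /=; rewrite /glue ifT.
  by apply: ih => //; exact: ltnW.
by rewrite (le_trans x0)// t_le//=; exact: ltnW.
Qed.

Lemma continuous_pw q m : (m <= N)%N ->
  (forall n, (n < m)%N -> (q n).[t n] = (q n.+1).[t n]) -> continuous (pw q m).
Proof.
elim: m => [|m ih] mN qm /=; first exact: continuous_horner.
apply: continuous_glue.
- by rewrite pw_node 1?ltnW// qm.
- by apply: ih => [|n nm]; [exact: ltnW|apply: qm; exact: ltnW].
- exact: continuous_horner.
Qed.

Lemma is_derive_pw q m : (m <= N)%N ->
  (forall n, (n < m)%N -> (q n).[t n] = (q n.+1).[t n]) ->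
  (forall n, (n < m)%N -> (q n)^`().[t n] = (q n.+1)^`().[t n]) ->
  forall x : R, is_derive x (1 : R) (pw q m) (pw (fun n => (q n)^`()) m x).
Proof.
elim: m => [|m ih] mN qm qm' /=.
  by move=> x; exact: is_derive_poly.
apply: is_derive_glue.
- by rewrite pw_node 1?ltnW// qm.
- by rewrite pw_node 1?ltnW// qm'.
- by apply: ih => [|n nm|n nm]; [exact: ltnW|apply: qm; exact: ltnW|apply: qm'; exact: ltnW].
Qed.

Lemma measurable_pw q m : measurable_fun setT (pw q m).
Proof.
elim: m => [|m ih] /=; last apply: measurable_glue => //.
  by apply: continuous_measurable_fun; exact: continuous_horner.
by apply: continuous_measurable_fun; exact: continuous_horner.
Qed.

Lemma bounded_pw q m a b : exists M, forall x, a <= x <= b -> `|pw q m x| <= M.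
Proof.
have bp (p : {poly R}) : exists M, forall x, a <= x <= b -> `|p.[x]| <= M.
  by apply: continuous_bounded_segment; exact: continuous_horner.
elim: m => [|m [M1 h1]] /=; first exact: bp.
have [M2 h2] := bp (q m.+1); exists (Num.max M1 M2) => x axb.
by rewrite /glue; case: ifP => _; rewrite le_max ?h1 ?h2// orbT.
Qed.

End piecewise_polynomials.

(** * Square integrability and integrals over intervals *)

Section square_integrable.
Context {R : realType}.
Notation mu := (@lebesgue_measure R).
Implicit Types (v f g : R -> R) (a b c M T : R).

Lemma bounded_integrable_segment f a b M : measurable_fun `[a, b] f ->
  (forall x, a <= x <= b -> `|f x| <= M) -> mu.-integrable `[a, b] (EFin \o f).
Proof.
move=> mf fM; apply: measurable_bounded_integrable => //.
  by rewrite /= lebesgue_measure_itv/=; case: ifP; rewrite ltry.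
exists M; split; first exact: num_real.
move=> K MK x /=; rewrite in_itv/= => axb.
by rewrite (le_trans (fM x axb))// ltW.
Qed.

Lemma Rintegral_itv_oo_cc f a b : mu.-integrable `[a, b] (EFin \o f) ->
  \int[mu]_(x in `]a, b[) f x = \int[mu]_(x in `[a, b]) f x.
Proof.
move=> fi; have fab : mu.-integrable `]a, b] (EFin \o f).
  by apply: integrableS fi => //; exact: subset_itv_oc_cc.
rewrite -Rintegral_itv_obnd_cbnd// Rintegral_itv_bndo_bndc//.
by apply: integrableS fi => //; exact: subset_itv_oo_cc.
Qed.

Lemma Rintegral_segment_split f a b c : a <= b -> b <= c ->
  mu.-integrable `[a, c] (EFin \o f) ->
  \int[mu]_(x in `[a, c]) f x =
  \int[mu]_(x in `[a, b]) f x + \int[mu]_(x in `[b, c]) f x.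
Proof.
move=> ab bc fi.
have := @Rintegral_itvB R f (BLeft a) (BRight c) b fi; rewrite !bnd_simp.
move=> /(_ ab bc)/eqP; rewrite subr_eq addrC => /eqP ->; congr (_ + _).
apply: Rintegral_itv_obnd_cbnd; apply: integrableS fi => //.
by apply: subset_itvr; rewrite bnd_simp.
Qed.

Lemma eq_Rintegral_oo f g a b : (forall x, a < x < b -> f x = g x) ->
  \int[mu]_(x in `]a, b[) f x = \int[mu]_(x in `]a, b[) g x.
Proof.
move=> fg; apply: eq_Rintegral => x; rewrite inE/= in_itv/=; exact: fg.
Qed.

Lemma L2_bounded T v M : measurable_fun setT v ->
  (forall x, 0 <= x <= T -> `|v x| <= M) -> L2 T v.
Proof.
move=> mv vM; rewrite /L2 inE; apply/andP; split.
  rewrite inE/=; apply: (measurable_restrictT _ _).1 => //.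
  exact: measurable_funTS.
rewrite inE/= /finite_norm unlock poweR_lty//.
(* Outside the interval the restriction takes the default value [point], which is 0 in [R] and in
   the extended reals. *)
rewrite (_ : (fun x => _) = (fun x => (`|(v x)%:E| `^ 2)%E) \_ `]0, T[); last first.
  apply/funext => x; rewrite /patch/=; case: (x \in _) => //=.
  by rewrite -[(point : R)]/(0 : R) -[(point : \bar R)]/(0%E : \bar R) normr0 powR0 ?pnatr_eq0.
rewrite -integral_mkcond.
have -> : (fun x => `|(v x)%:E| `^ 2)%E = EFin \o (fun x => v x ^+ 2).
  apply/funext => x.
  by rewrite -[`|_|%E]/(`|v x|%:E) poweR_EFin powR_mulrn// real_normK ?num_real.
apply: integrable_lty => //.
have fi : mu.-integrable `[0, T] (EFin \o (fun x => v x ^+ 2)).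
  apply: (@bounded_integrable_segment _ _ _ (M ^+ 2)).
    by apply: measurable_funX; exact: measurable_funTS.
  move=> x xT; rewrite normrX; have vxM := vM _ xT.
  by rewrite lerXn2r// nnegrE// (le_trans _ vxM).
by apply: integrableS fi => //; exact: subset_itv_oo_cc.
Qed.

Lemma L2_integrable T v : L2 T v ->
  measurable_fun `]0, T[ v /\
  mu.-integrable `]0, T[ (EFin \o (fun x => v x ^+ 2)).
Proof.
move=> v2; split.
  apply: (measurable_restrictT _ _).2 => //.
  by move: v2; rewrite /L2 inE => /andP[]; rewrite inE.
have := Lfun2_integrable_sqr v2.
rewrite (_ : EFin \o _ = (EFin \o (fun x => v x ^+ 2)) \_ `]0, T[); last first.
  apply/funext => x; rewrite /= /patch; case: ifP => // _.
  by rewrite expr0n.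
by move=> /(integrable_restrict mu); rewrite setTI; apply.
Qed.

End square_integrable.

(** * Sobolev regularity of piecewise polynomials *)

Section piecewise_weak_derivative.
Context {R : realType} (t : nat -> R) (N : nat) (T : R).
Hypothesis t_part : is_partition T N t.
Notation mu := (@lebesgue_measure R).
Implicit Types (q : nat -> {poly R}) (phi h : R -> R).

Let t0 : t 0%N = 0. Proof. by case: t_part. Qed.
Let tN : t N = T. Proof. by case: t_part. Qed.
Let t_incr : forall n, (1 <= n <= N)%N -> t n.-1 < t n.
Proof. by case: t_part. Qed.

Lemma t_ge0 n : (n <= N)%N -> 0 <= t n.
Proof. by move=> nN; rewrite -t0 (t_le _ N). Qed.

Lemma t_leT n : (n <= N)%N -> t n <= T.
Proof. by move=> nN; rewrite -tN (t_le _ N)// nN leqnn. Qed.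

Lemma L2_pw q : L2 T (pw t q N).
Proof.
have [M qM] := bounded_pw t q N 0 T.
by apply: L2_bounded qM; exact: measurable_pw.
Qed.

Lemma integrable_pw_mul q m h a b : continuous h ->
  mu.-integrable `[a, b] (EFin \o (fun x => pw t q m x * h x)).
Proof.
move=> ch; have [M1 qM1] := bounded_pw t q m a b.
have [M2 hM2] := continuous_bounded_segment h a b ch.
apply: (@bounded_integrable_segment _ _ _ _ (M1 * M2)).
  apply: measurable_funM; first by apply: measurable_funTS; exact: measurable_pw.
  by apply: measurable_funTS; exact: continuous_measurable_fun.
by move=> x axb; rewrite normrM ler_pM// ?qM1// hM2.
Qed.

(** Each piece contributes the increment of [q n * phi], and the contributions at interior nodes
    telescope. The case [m = 0] stands apart because [q 0] and [q 1] are not assumed to agree at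
    0. *)
Lemma pw_integration_by_parts q phi m : (m <= N)%N ->
  (forall n, (0 < n < N)%N -> (q n).[t n] = (q n.+1).[t n]) ->
  (forall x, derivable phi x 1) -> continuous (derive1 phi) ->
  \int[mu]_(x in `[0, t m]) (pw t q N x * derive1 phi x) +
  \int[mu]_(x in `[0, t m]) (pw t (fun n => (q n)^`()) N x * phi x) =
  if m is 0%N then 0 else (q m).[t m] * phi (t m) - (q 1%N).[0] * phi 0.
Proof.
move=> + qN dphi cphi'; have cphi : continuous phi.
  by move=> x; apply/differentiable_continuous/derivable1_diffP.
elim: m => [_|m ih mN].
  by rewrite t0 set_itv1 !Rintegral_set1 addr0.
have mm : t m <= t m.+1 by rewrite ltW// (t_incr m.+1).
rewrite (@Rintegral_segment_split _ _ _ (t m))//; last 2 first.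
- by apply: t_ge0; exact: ltnW.
- exact: integrable_pw_mul.
rewrite [X in _ + X](@Rintegral_segment_split _ _ _ (t m))//; last 2 first.
- by apply: t_ge0; exact: ltnW.
- exact: integrable_pw_mul.
rewrite addrACA ih ?(ltnW mN)//.
have piece (p : nat -> {poly R}) (h : R -> R) : continuous h ->
    \int[mu]_(x in `[t m, t m.+1]) (pw t p N x * h x) =
    \int[mu]_(x in `[t m, t m.+1]) ((p m.+1).[x] * h x).
  (* Endpoints are dropped because at [t m] the function [pw] takes the value of the previous
     piece. *)
  move=> ch; rewrite -Rintegral_itv_oo_cc; last exact: integrable_pw_mul.
  rewrite -[RHS]Rintegral_itv_oo_cc; last first.
    apply: continuous_integrable; apply: continuousMr => //.
    exact: continuous_horner.
  apply: eq_Rintegral_oo => x /andP[mx xm]; congr (_ * _).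
  by rewrite (pwE _ _ t_incr _ m.+1)//= mx ltW.
rewrite !piece// -RintegralD_cont; last 2 first.
- by apply: continuousMr => //; exact: continuous_horner.
- by apply: continuousMr => //; exact: continuous_horner.
have dF (x : R) : is_derive x (1 : R) (fun x => (q m.+1).[x] * phi x)
    ((q m.+1).[x] * derive1 phi x + (q m.+1)^`().[x] * phi x).
  have dphix : is_derive x (1 : R) phi (derive1 phi x).
    by apply: DeriveDef; [exact: dphi|rewrite derive1E].
  have := is_deriveM (is_derive_poly (q m.+1) x) dphix.
  rewrite /GRing.scale/= (mulrC (phi x)). exact.
rewrite (Rintegral_FTC2 _ _ _ _ mm _ dF); last first.
  by apply: continuousDr; apply: continuousMr => //; exact: continuous_horner.
case: m mN {ih mm piece dF} => [|m] mN; first by rewrite add0r t0.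
rewrite qN//; lra.
Qed.

Lemma weak_derivative_pw q :
  (forall n, (0 < n < N)%N -> (q n).[t n] = (q n.+1).[t n]) ->
  weak_derivative T (pw t q N) (pw t (fun n => (q n)^`()) N).
Proof.
move=> qN phi [dphi cphi' [K [_ KT] phiK]].
have cphi : continuous phi.
  by move=> x; apply/differentiable_continuous/derivable1_diffP.
have phi0 : phi 0 = 0 by apply: phiK => /KT/=; rewrite in_itv/= ltxx.
have phiT : phi T = 0 by apply: phiK => /KT/=; rewrite in_itv/= ltxx andbF.
rewrite !Rintegral_itv_oo_cc; [|exact: integrable_pw_mul..].
apply/eqP; rewrite -subr_eq0 opprK -tN pw_integration_by_parts//.
by case: N tN => // n ->; rewrite phi0 phiT !mulr0 subrr.
Qed.

Lemma Sobolev1_pw q :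
  (forall n, (0 < n < N)%N -> (q n).[t n] = (q n.+1).[t n]) ->
  Sobolev T 1 (pw t q N).
Proof.
move=> qN; split; first exact: L2_pw.
exists (pw t (fun n => (q n)^`()) N); [exact: weak_derivative_pw|exact: L2_pw].
Qed.

Lemma Sobolev2_pw q :
  (forall n, (0 < n < N)%N -> (q n).[t n] = (q n.+1).[t n]) ->
  (forall n, (0 < n < N)%N -> (q n)^`().[t n] = (q n.+1)^`().[t n]) ->
  Sobolev T 2 (pw t q N).
Proof.
move=> qN qN'; split; first exact: L2_pw.
exists (pw t (fun n => (q n)^`()) N); first exact: weak_derivative_pw.
exact: Sobolev1_pw.
Qed.

End piecewise_weak_derivative.

(** * Continuity of the derivative *)

Section bump.
Context {R : realType}.
Notation mu := (@lebesgue_measure R).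

(** Two continuous derivatives are recorded so that both [psi] and [psi1] can serve as $C^1$ test
    functions. *)
Record is_bump (a e : R) (psi psi1 psi2 : R -> R) : Prop := {
  bump_derive : forall x : R, is_derive x (1 : R) psi (psi1 x);
  bump_derive1 : forall x : R, is_derive x (1 : R) psi1 (psi2 x);
  bump_continuous2 : continuous psi2;
  bump_out : forall x, ~~ (a - e <= x <= a + e) ->
    [/\ psi x = 0, psi1 x = 0 & psi2 x = 0];
  bump_le1 : forall x, psi x ^+ 2 <= 1;
  bump_center : psi a = 1;
  bump_center1 : psi1 a = 0 }.

(** For [p.[0] = 0] this is [p] composed with the positive part. *)
Let pos (p : {poly R}) : R -> R := glue 0 (fun=> 0) (horner p).

Let is_derive_pos (p : {poly R}) : p.[0] = 0 -> p^`().[0] = 0 ->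
  forall x : R, is_derive x (1 : R) (pos p) (pos p^`() x).
Proof.
move=> p0 p'0; apply: is_derive_glue => //.
Qed.

(* [max(0, 1 - ((x - a) / e) ^ 2) ^ 3]: the cube makes it of class C^2. *)
Lemma bump_exists (a e : R) : 0 < e ->
  exists psi psi1 psi2, is_bump a e psi psi1 psi2.
Proof.
move=> e0.
pose w : {poly R} := 1 - (e ^+ 2)^-1 *: ('X - a%:P) ^+ 2.
have wE x : w.[x] = 1 - ((x - a) / e) ^+ 2.
  by rewrite /w !hornerE /= expr_div_n; ring.
have w'a : w^`().[a] = 0.
  rewrite /w derivB derivC sub0r derivZ deriv_exp derivB derivX derivC subr0.
  by rewrite mul1r /= expr1 hornerN hornerZ hornerMn hornerXsubC subrr mul0rn mulr0 oppr0.
pose p : {poly R} := 'X^3.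
have p1 : p^`() = 3 *: 'X^2 by rewrite derivXn /= scaler_nat.
have p2 : p^`()^`() = 6 *: 'X.
  by rewrite p1 derivZ derivXn /= expr1 -['X *+ 2]scaler_nat scalerA -natrM.
have p0 : p.[0] = 0 by rewrite /p hornerXn expr0n.
have p10 : p^`().[0] = 0 by rewrite p1 hornerZ hornerXn expr0n mulr0.
have p20 : p^`()^`().[0] = 0 by rewrite p2 hornerZ hornerX mulr0.
have dw (x : R) := is_derive_poly w x.
have dw' (x : R) := is_derive_poly w^`() x.
have dcomp (q : {poly R}) : q.[0] = 0 -> q^`().[0] = 0 ->
    forall x : R, is_derive x (1 : R) (pos q \o horner w) (pos q^`() w.[x] * w^`().[x]).
  by move=> q0 q'0 x; apply: is_derive1_comp; exact: is_derive_pos.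
exists (pos p \o horner w), (fun x => pos p^`() w.[x] * w^`().[x]),
  (fun x => pos p^`()^`() w.[x] * w^`().[x] * w^`().[x] + pos p^`() w.[x] * w^`()^`().[x]).
have cw q : continuous (horner q : R -> R) by exact: continuous_horner.
have cpos (q : {poly R}) : q.[0] = 0 -> continuous (fun x => pos q w.[x]).
  move=> q0 x; apply: (@continuous_comp _ _ _ (horner w) (pos q)); first exact: cw.
  by apply: continuous_glue => //; exact: cst_continuous.
split.
- exact: dcomp.
- move=> x; have := is_deriveM (dcomp p^`() p10 p20 x) (dw' x).
  rewrite (_ : _ *: _ + _ = pos p^`()^`() w.[x] * w^`().[x] * w^`().[x] +
    pos p^`() w.[x] * w^`()^`().[x]); first exact.
  by rewrite /GRing.scale/=; ring.
- by apply: continuousDr; apply: continuousMr => //; [apply: continuousMr => //|]; exact: cpos.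
- move=> x xout; suff w0 : w.[x] <= 0.
    by rewrite /= /pos /glue w0 !mul0r addr0.
  rewrite wE subr_le0 expr_div_n ler_pdivlMr ?exprn_gt0// mul1r.
  rewrite -[leRHS]real_normK ?num_real// lerXn2r ?nnegrE ?(ltW e0)//.
  by rewrite leNgt; apply: contra xout => /ltW; rewrite ler_distl.
- move=> x; rewrite /= /pos /glue; case: ifP => w0; first by rewrite expr0n.
  have w1 : w.[x] <= 1 by rewrite wE gerBl sqr_ge0.
  have {}w0 : 0 <= w.[x] by rewrite ltW// ltNge w0.
  by rewrite /p hornerXn -exprM exprn_ile1.
- by rewrite /= /pos /glue wE subrr mul0r expr0n subr0 leNgt ltr01/= hornerXn expr1n.
- by rewrite w'a mulr0.
Qed.

End bump.

(** * Matching of one-sided derivatives in $H^2$ *)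

Section no_jump.
Context {R : realType}.
Notation mu := (@lebesgue_measure R).
Implicit Types (a l u T e d : R) (h psi V : R -> R) (p q : {poly R}).

(** The pointwise bound comes from $(dA-B)^2 \ge 0$ and also dominates the product, which makes it
    integrable. *)
Lemma young_Rintegral T h psi d : 0 < d -> measurable_fun `]0, T[ h ->
  mu.-integrable `]0, T[ (EFin \o (fun x => h x ^+ 2)) -> continuous psi ->
  `|\int[mu]_(x in `]0, T[) (h x * psi x)| <=
  d / 2 * \int[mu]_(x in `]0, T[) (h x ^+ 2) +
  (2 * d)^-1 * \int[mu]_(x in `[0, T]) (psi x ^+ 2).
Proof.
move=> d0 mh ih cpsi.
have ipsi : mu.-integrable `[0, T] (EFin \o (fun x => psi x ^+ 2)).
  by apply: continuous_integrable; exact: continuous_sqr.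
have ipsi' : mu.-integrable `]0, T[ (EFin \o (fun x => psi x ^+ 2)).
  by apply: integrableS ipsi => //; exact: subset_itv_oo_cc.
have young x : `|h x * psi x| <= d / 2 * h x ^+ 2 + (2 * d)^-1 * psi x ^+ 2.
  rewrite normrM -(real_normK (num_real (h x))) -(real_normK (num_real (psi x))).
  rewrite -subr_ge0; set A := `|h x|; set B := `|psi x|.
  rewrite (_ : _ - _ = (2 * d)^-1 * (d * A - B) ^+ 2).
    by rewrite mulr_ge0 ?sqr_ge0// invr_ge0 mulr_ge0// ltW.
  by field; rewrite gt_eqF.
have i1 : mu.-integrable `]0, T[ (EFin \o (fun x => d / 2 * h x ^+ 2)).
  rewrite (_ : _ \o _ = (fun x => (d / 2)%:E * (h x ^+ 2)%:E)%E); last exact/funext.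
  exact: integrableZl.
have i2 : mu.-integrable `]0, T[ (EFin \o (fun x => (2 * d)^-1 * psi x ^+ 2)).
  rewrite (_ : _ \o _ = (fun x => (2 * d)^-1%:E * (psi x ^+ 2)%:E)%E); last exact/funext.
  exact: integrableZl.
have i12 : mu.-integrable `]0, T[
    (EFin \o (fun x => d / 2 * h x ^+ 2 + (2 * d)^-1 * psi x ^+ 2)).
  rewrite (_ : _ \o _ =
    (fun x => (d / 2 * h x ^+ 2)%:E + ((2 * d)^-1 * psi x ^+ 2)%:E)%E); last exact/funext.
  exact: integrableD.
have mhpsi : measurable_fun `]0, T[ (fun x => h x * psi x).
  apply: measurable_funM => //.
  by apply: measurable_funTS; exact: continuous_measurable_fun.
have ihpsi : mu.-integrable `]0, T[ (EFin \o (fun x => h x * psi x)).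
  apply: le_integrable i12 => //; first exact/measurable_EFinP.
  by move=> x _ /=; rewrite lee_fin (le_trans (young x))// ler_norm.
rewrite (le_trans (le_normr_Rintegral _ ihpsi))//.
apply: (@le_trans _ _ (\int[mu]_(x in `]0, T[)
    (d / 2 * h x ^+ 2 + (2 * d)^-1 * psi x ^+ 2))).
  apply: le_Rintegral => //.
  exact: integrable_norm.
by rewrite RintegralD// !RintegralZl// (Rintegral_itv_oo_cc _ _ _ ipsi).
Qed.

(** The integrand is at most 1 on an interval of length [2 * e] and vanishes elsewhere. *)
Lemma Rintegral_bump_sqr_le T a e psi psi1 psi2 : 0 < e -> 0 <= a - e ->
  a + e <= T -> is_bump a e psi psi1 psi2 ->
  \int[mu]_(x in `[0, T]) (psi x ^+ 2) <= 2 * e.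
Proof.
move=> e0 ae aeT B.
have cpsi : continuous psi.
  move=> x; apply/differentiable_continuous/derivable1_diffP.
  by case: (bump_derive _ _ _ _ _ B x).
have ipsi x y : mu.-integrable `[x, y] (EFin \o (fun x => psi x ^+ 2)).
  by apply: continuous_integrable; exact: continuous_sqr.
have aee : a - e <= a + e by rewrite lerD2l ge0_cp// ltW.
have zero x y : (forall z, x < z < y -> psi z = 0) ->
    \int[mu]_(z in `[x, y]) (psi z ^+ 2) = 0.
  move=> pz; rewrite -Rintegral_itv_oo_cc//.
  rewrite (eq_Rintegral_oo _ (cst 0)) ?Rintegral_cst ?mul0r// => z /pz ->.
  by rewrite expr0n.
rewrite (Rintegral_segment_split _ _ (a - e))//; last exact: le_trans aeT.
rewrite zero ?add0r; last first.
  by move=> z /andP[_ za]; case: (bump_out _ _ _ _ _ B z) => //; rewrite leNgt za.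
rewrite (Rintegral_segment_split _ _ (a + e))//.
rewrite [X in _ + X]zero ?addr0; last first.
  move=> z /andP[az _]; case: (bump_out _ _ _ _ _ B z) => //.
  by rewrite [X in _ && X]leNgt az andbF.
have -> : 2 * e = \int[mu]_(x in `[a - e, a + e]) ((x - (a - e)) ^+ 0).
  by rewrite Rintegral_shift_exp// expr1 divr1; ring.
apply: le_Rintegral_cont => //.
- exact: continuous_sqr.
- by under eq_fun do rewrite expr0; exact: cst_continuous.
by move=> x _; rewrite expr0; exact: (bump_le1 _ _ _ _ _ B).
Qed.

(* [J] is the jump and [B] the piecewise second derivative of [V]; two
   integrations by parts give [J = \int g2 psi - \int B psi], and Young's
   inequality with weight [d] and a bump of width [e <= d ^ 2] bounds this by a
   multiple of [d]. *)
Lemma Sobolev2_no_jump T l a u V p q : 0 <= l -> l < a -> a < u -> u <= T ->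
  Sobolev T 2 V -> p.[a] = q.[a] ->
  (forall x, l < x < u -> V x = glue a (horner p) (horner q) x) ->
  p^`().[a] = q^`().[a].
Proof.
move=> l0 la au uT [_ [g Vg [_ [g2 gg2 Lg2]]]] pqa VE.
have [mg2 ig2] := L2_integrable _ _ Lg2.
pose B := glue a (horner p^`()^`()) (horner q^`()^`()).
pose J := q^`().[a] - p^`().[a].
pose r i : {poly R} := if i is 0%N then p^`()^`() else q^`()^`().
have BE : B = pw (fun=> a) r 1 by [].
have LB : L2 T B.
  have [M BM] := bounded_pw (fun=> a) r 1 0 T.
  by apply: L2_bounded BM; exact: measurable_pw.
have [mB iB] := L2_integrable _ _ LB.
set H2 := \int[mu]_(x in `]0, T[) (g2 x ^+ 2).
set B2 := \int[mu]_(x in `]0, T[) (B x ^+ 2).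
(* The final bound is [d * (H2 / 2 + B2 / 2 + 2)], one [d] coming from the bump term of each use of
   Young's inequality. *)
pose K := H2 + B2 + 2.
have K0 : 0 < K.
  by rewrite ltr_wpDl// addr_ge0// Rintegral_ge0// => x _; exact: sqr_ge0.
suff key d : 0 < d -> `|J| <= d * K.
  apply/eqP; rewrite eq_sym -subr_eq0 -/J -normr_eq0 eq_le normr_ge0 andbT.
  rewrite leNgt; apply/negP => J0.
  (* This [d] would give [|J| <= |J| / 2], impossible for a nonzero jump. *)
  have := key (`|J| / (2 * K)); rewrite divr_gt0 ?mulr_gt0// => /(_ isT).
  rewrite (_ : _ / _ * K = `|J| / 2); last by field; rewrite gt_eqF.
  by lra.
move=> d0.
(* The second bound, with its factor 1/2, keeps the support of the bump strictly inside [(l, u)]. *)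
pose e := Num.min (d ^+ 2) (Num.min (a - l) (u - a) / 2).
have e0 : 0 < e.
  by rewrite lt_min exprn_gt0//= divr_gt0// lt_min !subr_gt0 la.
have ed : e <= d ^+ 2 by rewrite ge_min lexx.
have ele : e <= Num.min (a - l) (u - a) / 2 by rewrite ge_min lexx orbT.
have ml : Num.min (a - l) (u - a) <= a - l by rewrite ge_min lexx.
have mu' : Num.min (a - l) (u - a) <= u - a by rewrite ge_min lexx orbT.
have lae : l < a - e by lra.
have aeu : a + e < u by lra.
have [psi [psi1 [psi2 bmp]]] := bump_exists a e e0.
have dpsi := bump_derive _ _ _ _ _ bmp.
have dpsi1 := bump_derive1 _ _ _ _ _ bmp.
have cpsi2 := bump_continuous2 _ _ _ _ _ bmp.
have cpsi1 : continuous psi1.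
  by move=> x; apply/differentiable_continuous/derivable1_diffP; case: (dpsi1 x).
have cpsi : continuous psi.
  by move=> x; apply/differentiable_continuous/derivable1_diffP; case: (dpsi x).
have psi1E : derive1 psi = psi1.
  by apply/funext => x; rewrite derive1E; case: (dpsi x).
have psi2E : derive1 psi1 = psi2.
  by apply/funext => x; rewrite derive1E; case: (dpsi1 x).
have Kc : compact `[a - e, a + e] /\ `[a - e, a + e] `<=` `]0, T[.
  split; first exact: segment_compact.
  move=> x /=; rewrite !in_itv/= => /andP[x1 x2].
  by apply/andP; split; lra.
have Cpsi : C1c T psi.
  split; first by move=> x; case: (dpsi x).
  - by rewrite psi1E.
  exists `[a - e, a + e]%classic => // x /=; rewrite in_itv/= => /negP xout.
  by case: (bump_out _ _ _ _ _ bmp x).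
have Cpsi1 : C1c T psi1.
  split; first by move=> x; case: (dpsi1 x).
  - by rewrite psi2E.
  exists `[a - e, a + e]%classic => // x /=; rewrite in_itv/= => /negP xout.
  by case: (bump_out _ _ _ _ _ bmp x).
(* The weak derivative is used twice, first against [psi1] and then against [psi]; the signs
   cancel. *)
have E1 : \int[mu]_(x in `]0, T[) (V x * psi2 x) =
          \int[mu]_(x in `]0, T[) (g2 x * psi x).
  have := Vg _ Cpsi1; rewrite psi2E => ->.
  by have := gg2 _ Cpsi; rewrite psi1E => ->; rewrite opprK.
pose G := glue a (horner p) (horner q).
have cG : continuous G by apply: continuous_glue => //; exact: continuous_horner.
have E2 : \int[mu]_(x in `]0, T[) (V x * psi2 x) = \int[mu]_(x in `[0, T]) (G x * psi2 x).
  rewrite -Rintegral_itv_oo_cc; last first.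
    by apply: continuous_integrable; exact: continuousMr.
  apply: eq_Rintegral_oo => x _.
  have [xin|xout] := boolP (a - e <= x <= a + e).
    rewrite VE//; case/andP: xin => x1 x2; apply/andP; split; lra.
  by case: (bump_out _ _ _ _ _ bmp x xout) => _ _ ->; rewrite !mulr0.
(* Green's formula: $w\psi' - w'\psi$ is an antiderivative of $w\psi'' - w''\psi$. *)
have green (w : {poly R}) c b : c <= b ->
    \int[mu]_(x in `[c, b]) (w.[x] * psi2 x) =
    w.[b] * psi1 b - w^`().[b] * psi b - (w.[c] * psi1 c - w^`().[c] * psi c) +
    \int[mu]_(x in `[c, b]) (w^`()^`().[x] * psi x).
  move=> cb; apply/eqP; rewrite -subr_eq; apply/eqP.
  have ch (v : {poly R}) : continuous (horner v) by exact: continuous_horner.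
  rewrite -RintegralB_cont; [|exact: continuousMr|exact: continuousMr].
  apply: (Rintegral_FTC2 (fun x => w.[x] * psi1 x - w^`().[x] * psi x)) => //.
    by apply: continuousBr; exact: continuousMr.
  move=> x; have := is_deriveB (is_deriveM (is_derive_poly w x) (dpsi1 x))
                               (is_deriveM (is_derive_poly w^`() x) (dpsi x)).
  rewrite (_ : _ - _ = w.[x] * psi2 x - w^`()^`().[x] * psi x); first exact.
  by rewrite /GRing.scale/=; ring.
have out0 x : x < a - e -> psi x = 0 /\ psi1 x = 0.
  by move=> xa; case: (bump_out _ _ _ _ _ bmp x) => //; rewrite leNgt xa.
have out1 x : a + e < x -> psi x = 0 /\ psi1 x = 0.
  move=> ax; case: (bump_out _ _ _ _ _ bmp x) => //.
  by rewrite [X in _ && X]leNgt ax andbF.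
have [p0 p10] : psi 0 = 0 /\ psi1 0 = 0 by apply: out0; lra.
have [pT p1T] : psi T = 0 /\ psi1 T = 0 by apply: out1; lra.
have a0 : 0 <= a by lra.
have aT : a <= T by lra.
have iBpsi x y : mu.-integrable `[x, y] (EFin \o (fun x => B x * psi x)).
  by rewrite BE; exact: integrable_pw_mul.
have E3 : \int[mu]_(x in `[0, T]) (G x * psi2 x) =
    J + \int[mu]_(x in `]0, T[) (B x * psi x).
  rewrite Rintegral_itv_oo_cc// !(Rintegral_segment_split _ 0 a T)//; last first.
    by apply: continuous_integrable; exact: continuousMr.
  have -> : \int[mu]_(x in `[0, a]) (G x * psi2 x) =
      \int[mu]_(x in `[0, a]) (p.[x] * psi2 x).
    apply: eq_Rintegral => x; rewrite inE/= in_itv/= => /andP[_ xa].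
    by rewrite /G /glue xa.
  have -> : \int[mu]_(x in `[a, T]) (G x * psi2 x) =
      \int[mu]_(x in `[a, T]) (q.[x] * psi2 x).
    apply: eq_Rintegral => x; rewrite inE/= in_itv/= => /andP[ax _].
    rewrite /G /glue; case: ifPn => // xa; suff -> : x = a by rewrite pqa.
    by apply/eqP; rewrite eq_le xa.
  have -> : \int[mu]_(x in `[0, a]) (B x * psi x) =
      \int[mu]_(x in `[0, a]) (p^`()^`().[x] * psi x).
    apply: eq_Rintegral => x; rewrite inE/= in_itv/= => /andP[_ xa].
    by rewrite /B /glue xa.
  have -> : \int[mu]_(x in `[a, T]) (B x * psi x) =
      \int[mu]_(x in `[a, T]) (q^`()^`().[x] * psi x).
    rewrite -Rintegral_itv_oo_cc// -[RHS]Rintegral_itv_oo_cc; last first.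
      by apply: continuous_integrable; apply: continuousMr => //; exact: continuous_horner.
    by apply: eq_Rintegral_oo => x /andP[ax _]; rewrite /B /glue leNgt ax.
  (* Boundary terms at 0 and [T] vanish; at [a], where [psi] is 1 and [psi1] is 0, only the
     difference of slopes survives. *)
  rewrite !green// p0 p10 pT p1T (bump_center _ _ _ _ _ bmp) (bump_center1 _ _ _ _ _ bmp).
  by rewrite /J; ring.
have ae0 : 0 <= a - e by lra.
have aeT : a + e <= T by lra.
have Psi := Rintegral_bump_sqr_le _ _ _ _ _ _ e0 ae0 aeT bmp.
have Y1 := young_Rintegral _ _ _ _ d0 mg2 ig2 cpsi.
have Y2 := young_Rintegral _ _ _ _ d0 mB iB cpsi.
have JE : J = \int[mu]_(x in `]0, T[) (g2 x * psi x) -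
              \int[mu]_(x in `]0, T[) (B x * psi x).
  by rewrite -E1 E2 E3 addrK.
rewrite JE (le_trans (ler_normB _ _))// (le_trans (lerD Y1 Y2))//.
have : (2 * d)^-1 * \int[mu]_(x in `[0, T]) (psi x ^+ 2) <= d.
  rewrite ler_pdivrMl ?mulr_gt0// (le_trans Psi)//.
  by rewrite -mulrA ler_wpM2l // -expr2.
rewrite -/H2 -/B2 /K.
set P := (2 * d)^-1 * _ => Pd.
have dH2 : 0 <= d * H2 by rewrite mulr_ge0 ?(ltW d0)// Rintegral_ge0// => x _; exact: sqr_ge0.
have dB2 : 0 <= d * B2 by rewrite mulr_ge0 ?(ltW d0)// Rintegral_ge0// => x _; exact: sqr_ge0.
by lra.
Qed.

End no_jump.

(** * The global problem *)

Section clamp.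
Context {R : realType} (T : R).
Hypothesis T0 : 0 <= T.

Definition clamp (s : R) : R := Num.max 0 (Num.min s T).

Lemma clamp_in s : 0 <= clamp s <= T.
Proof. by rewrite le_max lexx/= ge_max T0 ge_min lexx orbT. Qed.

Lemma clamp_id s : 0 <= s <= T -> clamp s = s.
Proof. by move=> /andP[s0 sT]; rewrite /clamp min_l// max_r. Qed.

Lemma continuous_clamp : continuous clamp.
Proof.
move=> x; apply: (@continuous_max _ _ (fun=> 0) (fun s : R => Num.min s T) x).
  exact: cst_continuous.
apply: (@continuous_min _ _ (fun s : R => s) (fun=> T) x); first exact: cvg_id.
exact: cst_continuous.
Qed.

(** [clamp] takes its values in the segment, so continuity of [h] relative to the segment is
    enough. *)
Lemma continuous_comp_clamp (h : R -> R) : {within `[0, T], continuous h} ->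
  continuous (h \o clamp).
Proof.
move=> /subspace_continuousP ch x.
have cx : `[0, T]%classic (clamp x) by rewrite /= in_itv/= clamp_in.
apply: (@cvg_comp _ _ _ clamp h (nbhs x)
  (within `[0, T]%classic (nbhs (clamp x)))); last exact: ch.
move=> A; rewrite /within/= => wA.
have wAx : \forall y \near x, `[0, T]%classic (clamp y) -> A (clamp y).
  exact: (continuous_clamp x _ wA).
change (\forall y \near x, A (clamp y)).
apply: filterS wAx => y; apply.
by rewrite /= in_itv/= clamp_in.
Qed.

End clamp.

(** * Functions that are polynomial on an interval: derivatives and one-sided limits *)

Section polynomial_pieces.
Context {R : realType}.
Implicit Types (a b c d : R) (V : R -> R) (p : {poly R}).

Lemma near_itv_oo a b s : a < s < b -> \forall x \near s, a < x < b.
Proof.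
move=> /andP[sa sb]; near=> x; apply/andP; split; near: x.
  exact: lt_nbhsr.
exact: lt_nbhsl.
Unshelve. all: end_near. Qed.

Lemma derive1_piece V p a b : (forall x, a < x < b -> V x = p.[x]) ->
  forall x, a < x < b -> derive1 V x = p^`().[x].
Proof.
move=> Vp x axb; rewrite derive1E derivE derive1E.
apply: near_eq_derive; apply: filterS (near_itv_oo _ _ _ axb).
by move=> y; exact: Vp.
Qed.

Lemma derive2_piece V p a b : (forall x, a < x < b -> V x = p.[x]) ->
  forall x, a < x < b -> derive1n 2 V x = p^`()^`().[x].
Proof. by move=> Vp; do 2 apply: derive1_piece. Qed.

(** At each endpoint [V] and [p] have the same one-sided limit from inside, and both are continuous
    from that side. *)
Lemma piece_endpoints V p a b c d : c <= a -> a < b -> b <= d ->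
  {within `[c, d], continuous V} -> (forall x, a < x < b -> V x = p.[x]) ->
  V a = p.[a] /\ V b = p.[b].
Proof.
move=> ca ab bd cV Vp.
have cVab : {within `[a, b], continuous V}.
  apply: continuous_subspaceW cV => x /=; rewrite !in_itv/= => /andP[ax xb].
  by rewrite (le_trans ca ax) (le_trans xb bd).
have [_ Va Vb] := (continuous_within_itvP V ab).1 cVab.
have cp x : horner p @ x --> p.[x] by exact: continuous_horner.
split.
- apply: (@cvg_unique _ (@Rhausdorff R) (V x @[x --> a^'+]) _) => //.
  apply: cvg_trans (cvg_at_right_filter (cp a)); apply: near_eq_cvg.
  near=> x; rewrite Vp//; apply/andP; split; near: x.
    exact: nbhs_right_gt.
  exact: nbhs_right_lt.
- apply: (@cvg_unique _ (@Rhausdorff R) (V x @[x --> b^'-]) _) => //.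
  apply: cvg_trans (cvg_at_left_filter (cp b)); apply: near_eq_cvg.
  near=> x; rewrite Vp//; apply/andP; split; near: x.
    exact: nbhs_left_gt.
  exact: nbhs_left_lt.
Unshelve. all: end_near. Qed.

Lemma is_derive_right_quotient (W : R -> R) (d : R) :
  is_derive (0 : R) (1 : R) W d ->
  (fun h : R => h^-1 * (W h - W 0)) @ 0^'+ --> d.
Proof.
move=> [dW <-]; apply: cvg_dnbhs_at_right.
have -> : (fun h : R => h^-1 * (W h - W 0)) =
    (fun h : R => h^-1 *: (W (h *: (1 : R) + 0) - W 0)).
  by apply/funext => h; rewrite /GRing.scale/= mulr1 addr0.
exact: dW.
Qed.

Lemma right_quotient_piece V p b (d : R) : 0 < b -> V 0 = p.[0] ->
  (forall x, 0 < x < b -> V x = p.[x]) ->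
  (fun h : R => h^-1 * (V h - V 0)) @ 0^'+ --> d -> p^`().[0] = d.
Proof.
move=> b0 V0 Vp Vd.
apply: (@cvg_unique _ (@Rhausdorff R) ((fun h : R => h^-1 * (p.[h] - p.[0])) @ 0^'+) _) => //.
  by apply: is_derive_right_quotient; exact: is_derive_poly.
apply: cvg_trans Vd; apply: near_eq_cvg; near=> x.
rewrite V0 Vp//; apply/andP; split; near: x.
  exact: nbhs_right_gt.
exact: nbhs_right_lt.
Unshelve. all: end_near. Qed.

End polynomial_pieces.

(** * From the local problems to the discrete problem and back *)

Section discrete_problem.
Context {R : realType} (T u0 u1 : R) (f : R -> R -> R -> R) (L : R) (N : nat)
  (t : nat -> R) (r : nat -> nat).
Hypotheses (hT : 0 < T)
  (hfcont : forall u v : R, {within `[0, T], continuous (fun s => f s u v)})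
  (hL : 0 < L)
  (hfLip : forall s w1 v1 w2 v2 : R, 0 <= s <= T ->
       `|f s w1 v1 - f s w2 v2| <= L * (`|w1 - w2| + `|v1 - v2|))
  (hpart : is_partition T N t)
  (hr : forall n : nat, (1 <= n <= N)%N -> (2 <= r n)%N)
  (hstep : forall n : nat, (1 <= n <= N)%N ->
       L * step t n / 2 * Num.sqrt (8 + step t n ^+ 2) < 1).
Notation mu := (@lebesgue_measure R).
Implicit Types (p q phi : {poly R}) (V W : R -> R).

Let t0 : t 0%N = 0. Proof. by case: hpart. Qed.
Let tN : t N = T. Proof. by case: hpart. Qed.
Let t_incr : forall n, (1 <= n <= N)%N -> t n.-1 < t n.
Proof. by case: hpart. Qed.
Let tpred_ge0 n : (1 <= n <= N)%N -> 0 <= t n.-1.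
Proof.
move=> /andP[n1 nN]; apply: (t_ge0 t N T hpart).
by rewrite (leq_trans (leq_pred n)).
Qed.
Let t_leT' n : (1 <= n <= N)%N -> t n <= T.
Proof. by move=> /andP[n1 nN]; exact: (t_leT t N T hpart). Qed.

(* Extending [f] by its boundary values makes every integrand continuous on the
   whole line. *)
Definition fc (s u v : R) : R := f (clamp T s) u v.

Let cfc u v : continuous (fun s => fc s u v).
Proof.
exact: (continuous_comp_clamp T (ltW hT) (fun s => f s u v) (hfcont u v)).
Qed.

Let lipfc s u v u' v' :
  `|fc s u v - fc s u' v'| <= L * (`|u - u'| + `|v - v'|).
Proof. by apply: hfLip; exact: clamp_in (ltW hT) s. Qed.

(** The square of the assumed bound is $L^2(2k^2 + k^4/4)$, which exceeds the contraction constant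
    by $(Lk)^2$. *)
Let kappa1 n : (1 <= n <= N)%N ->
  L ^+ 2 * ((t n - t n.-1) ^+ 2 + (t n - t n.-1) ^+ 4 / 4) < 1.
Proof.
move=> nN; have := hstep _ nN; rewrite /step; set k := t n - t n.-1 => h.
have k0 : 0 <= k by rewrite subr_ge0 ltW// t_incr.
have Lk0 : 0 <= L * k / 2 * Num.sqrt (8 + k ^+ 2).
  by rewrite mulr_ge0 ?sqrtr_ge0// divr_ge0// mulr_ge0// ltW.
have : (L * k / 2 * Num.sqrt (8 + k ^+ 2)) ^+ 2 < 1.
  by rewrite expr_lt1.
rewrite exprMn sqr_sqrtr ?addr_ge0 ?sqr_ge0//; apply: le_lt_trans.
rewrite -subr_ge0 (_ : _ - _ = (L * k) ^+ 2); first exact: sqr_ge0.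
by field.
Qed.

(** Degree at most [r n - 2] means size at most [(r n).-1]. *)
Let loc n := galerkin (t n.-1) (t n) fc (r n).-1.

(** Links one term of the discrete equation to the residual in [galerkin]: inside the subinterval
    the derivatives of [V] are those of [p], and [fc] agrees with [f]. *)
Lemma Rintegral_piece n p phi V W : (1 <= n <= N)%N ->
  (forall x, t n.-1 < x < t n -> V x = p.[x]) ->
  (forall x, t n.-1 < x < t n -> W x = phi.[x]) ->
  \int[mu]_(s in Defs.subitv t n) (derive1n 2 V s * W s) -
  \int[mu]_(s in Defs.subitv t n) (f s (V s) (derive1 V s) * W s) =
  \int[mu]_(s in `[t n.-1, t n]) ((p^`()^`().[s] - rhs fc p s) * phi.[s]).
Proof.
move=> nN Vp Wp.
have ch q : continuous (horner q : R -> R) by exact: continuous_horner.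
have cr : continuous (rhs fc p) by exact: (continuous_rhs L fc (ltW hL) cfc lipfc).
have -> : \int[mu]_(s in Defs.subitv t n) (derive1n 2 V s * W s) =
    \int[mu]_(s in `[t n.-1, t n]) (p^`()^`().[s] * phi.[s]).
  rewrite -Rintegral_itv_oo_cc; last by apply: continuous_integrable; exact: continuousMr.
  apply: eq_Rintegral_oo => s sn.
  by rewrite Wp// (derive2_piece _ _ _ _ Vp).
have -> : \int[mu]_(s in Defs.subitv t n) (f s (V s) (derive1 V s) * W s) =
    \int[mu]_(s in `[t n.-1, t n]) (rhs fc p s * phi.[s]).
  rewrite -Rintegral_itv_oo_cc; last by apply: continuous_integrable; exact: continuousMr.
  apply: eq_Rintegral_oo => s sn.
  rewrite Wp// Vp// (derive1_piece _ _ _ _ Vp)// /rhs /fc clamp_id//.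
  case/andP: sn => /ltW s1 /ltW s2.
  by rewrite (le_trans (tpred_ge0 _ nN) s1) (le_trans s2 (t_leT' _ nN)).
rewrite -RintegralB_cont; [|exact: continuousMr..].
by apply: eq_Rintegral => s _; rewrite mulrBl.
Qed.

(** Local problems are solved from left to right, each starting from the end data of the previous
    piece. The linear polynomial [P 0] carries the initial data, so the first subinterval needs no
    separate treatment. *)
Lemma galerkin_sequence : exists P : nat -> {poly R},
  P 0%N = u0%:P + u1 *: 'X /\
  forall n, (1 <= n <= N)%N -> [/\ (size (P n) <= (r n).+1)%N,
    (P n).[t n.-1] = (P n.-1).[t n.-1],
    (P n)^`().[t n.-1] = (P n.-1)^`().[t n.-1] & loc n (P n)].
Proof.
(* Vacuous outside the range of indices, so that a choice function exists on all pairs. *)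
pose good n p q := (1 <= n <= N)%N -> [/\ (size q <= (r n).+1)%N,
    q.[t n.-1] = p.[t n.-1], q^`().[t n.-1] = p^`().[t n.-1] & loc n q].
have ex np : exists q, good np.1 np.2 q.
  case: np => n p /=; case nN : (1 <= n <= N)%N; last first.
    by exists 0; rewrite /good nN.
  (* With [m = r n - 2] the trial size is [m.+3 = (r n).+1] and the test size is
     [m.+1 = (r n).-1]. *)
  have [q [q1 q2 q3 q4]] := galerkin_exists _ _ L fc (t_incr _ nN) (ltW hL) cfc
    lipfc (kappa1 _ nN) (r n).-2 p.[t n.-1] p^`().[t n.-1].
  exists q => _; have := hr _ nN; rewrite /loc.
  by case: (r n) q1 q4 => [|[|m]].
have [G hG] := choice ex.
pose P := fix P n := if n is m.+1 then G (m.+1, P m) else u0%:P + u1 *: 'X.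
exists P; split => // -[//|n] nN; exact: (hG (n.+1, P n) nN).
Qed.

Lemma pw_piece (q : nat -> {poly R}) n : (1 <= n <= N)%N ->
  forall x, t n.-1 < x < t n -> pw t q N x = (q n).[x].
Proof.
move=> nN x /andP[x1 x2]; apply: (pwE t N t_incr) => //.
by rewrite x1 ltW.
Qed.

Lemma nodes_locate s : 0 < s <= T ->
  exists2 n, (1 <= n <= N)%N & t n.-1 < s <= t n.
Proof.
move=> /andP[s0 sT].
have loc' m : (m <= N)%N -> s <= t m ->
    exists2 n, (1 <= n <= N)%N & t n.-1 < s <= t n.
  elim: m => [|m ih] mN sm; first by move: sm; rewrite t0 leNgt s0.
  have [sm'|ms] := leP s (t m); first exact: ih (ltnW mN) sm'.
  by exists m.+1 => //=; rewrite ms.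
by apply: (loc' N) => //; rewrite tN.
Qed.

(** Matching values and slopes give membership in $H^2$, and the two sums agree term by term because
    a test function is an admissible polynomial on each subinterval. *)
Lemma discrete_solution_pw (P : nat -> {poly R}) : P 0%N = u0%:P + u1 *: 'X ->
  (forall n, (1 <= n <= N)%N -> [/\ (size (P n) <= (r n).+1)%N,
    (P n).[t n.-1] = (P n.-1).[t n.-1],
    (P n)^`().[t n.-1] = (P n.-1)^`().[t n.-1] & loc n (P n)]) ->
  discrete_solution T N t r f u0 u1 (pw t P N).
Proof.
move=> P0 HP.
have PN n : (n < N)%N -> (P n).[t n] = (P n.+1).[t n].
  by move=> nN; have [_ ->] := HP n.+1 nN.
have PN' n : (n < N)%N -> (P n)^`().[t n] = (P n.+1)^`().[t n].
  by move=> nN; have [_ _ ->] := HP n.+1 nN.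
have U0 : pw t P N 0 = u0.
  by rewrite (pw_le0 t N t_incr)// ?t0// P0 hornerD hornerC hornerZ hornerX mulr0 addr0.
split => //.
- split; first split.
  + by apply: (Sobolev2_pw t N T hpart) => n /andP[_ nN]; [exact: PN|exact: PN'].
  + move=> n nN; exists (P n); first by have [] := HP n nN.
    by move=> x; rewrite /Defs.subitv/= in_itv/=; exact: pw_piece.
  + apply: continuous_subspaceT.
    exact: (continuous_pw t N t_incr P N (leqnn N) PN).
- apply: is_derive_right_quotient.
  have := is_derive_pw t N t_incr P N (leqnn N) PN PN' 0.
  rewrite (pw_le0 t N t_incr) ?t0// P0.
  by rewrite derivD derivC add0r derivZ derivX hornerZ hornerC mulr1.
move=> phi [_ phiP]; apply: eq_big_nat => n nN.
have [q szq phiq] := phiP n nN.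
apply/eqP; rewrite -subr_eq0; apply/eqP.
rewrite (Rintegral_piece n (P n) q _ _ nN (pw_piece P n nN)); last first.
  by move=> x xn; apply: phiq; rewrite /Defs.subitv/= in_itv.
have [_ _ _] := HP n nN; apply.
rewrite (leq_trans szq)//; have := hr n nN.
by case: (r n) => [|[|m]]//= _; rewrite !subSS subn0.
Qed.

(** The pieces of [V] solve the local problems, so induction from the left identifies them with the
    [P n] through [galerkin_unique]. *)
Lemma discrete_solution_unique (P : nat -> {poly R}) V :
  P 0%N = u0%:P + u1 *: 'X ->
  (forall n, (1 <= n <= N)%N -> [/\ (size (P n) <= (r n).+1)%N,
    (P n).[t n.-1] = (P n.-1).[t n.-1],
    (P n)^`().[t n.-1] = (P n.-1)^`().[t n.-1] & loc n (P n)]) ->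
  discrete_solution T N t r f u0 u1 V ->
  forall s, 0 <= s <= T -> V s = pw t P N s.
Proof.
move=> P0 HP [[[SV Vpoly] cV] V0 V0' Vgal].
have exq n : exists q : {poly R}, (1 <= n <= N)%N -> (size q <= (r n).+1)%N /\
    forall x, t n.-1 < x < t n -> V x = q.[x].
  case nN : (1 <= n <= N)%N; last by exists 0.
  by have [q szq Vq] := Vpoly n nN; exists q => _; split.
have [q hq] := choice exq.
have szq n : (1 <= n <= N)%N -> (size (q n) <= (r n).+1)%N by move=> /hq[].
have Vq n : (1 <= n <= N)%N -> forall x, t n.-1 < x < t n -> V x = (q n).[x].
  by move=> /hq[].
have Vends n : (1 <= n <= N)%N ->
    V (t n.-1) = (q n).[t n.-1] /\ V (t n) = (q n).[t n].
  move=> nN; apply: (piece_endpoints V (q n) _ _ 0 T) => //.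
  - exact: tpred_ge0.
  - exact: t_incr.
  - exact: t_leT'.
  - exact: Vq.
have locq n : (1 <= n <= N)%N -> loc n (q n).
  move=> nN phi szphi.
  (* A test function supported on one subinterval isolates the local equation; the test space
     imposes no continuity at the nodes. *)
  pose phis i : {poly R} := if i == n then phi else 0.
  have phisE i : (1 <= i <= N)%N -> forall x, t i.-1 < x < t i ->
      pw t phis N x = (phis i).[x] by move=> iN; exact: pw_piece.
  have Sphi : spline_space T N t (fun n => (r n - 2)%N) 0 (pw t phis N).
    split; first exact: (L2_pw t N T).
    move=> i iN; exists (phis i); last first.
      by move=> x; rewrite /Defs.subitv/= in_itv/=; exact: phisE.
    rewrite /phis; case: eqP => [->|_]; last by rewrite size_poly0.
    rewrite (leq_trans szphi)//; have := hr n nN; case: (r n) => [|[|m]]//= _.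
    by rewrite !subSS subn0.
  have /eqP := Vgal _ Sphi; rewrite -subr_eq0 -sumrB => /eqP.
  rewrite (eq_big_nat _ _ (F2 := fun i => \int[mu]_(s in `[t i.-1, t i])
     (((q i)^`()^`().[s] - rhs fc (q i) s) * (phis i).[s]))); last first.
    by move=> i iN; apply: Rintegral_piece => //; [exact: Vq|exact: phisE].
  rewrite (bigD1_seq n) ?iota_uniq ?mem_index_iota//= big1_seq ?addr0; last first.
    move=> i /andP[/negbTE ni _]; rewrite /phis ni.
    under eq_Rintegral do rewrite horner0 mulr0.
    by rewrite Rintegral_cst// mul0r.
  by rewrite /phis eqxx.
have qP n : (1 <= n <= N)%N -> q n = P n.
  elim: n => [//|n ih] nN; have [szP PV PV' locP] := HP n.+1 nN.
  have [Va Vb] := Vends n.+1 nN.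
  have rE : (r n.+1).-1.+2 = (r n.+1).+1.
    by have := hr n.+1 nN; case: (r n.+1).
  apply: (galerkin_unique _ _ L fc (t_incr _ nN) (ltW hL) cfc lipfc
    (kappa1 _ nN) (r n.+1).-1); rewrite ?rE ?szq//; last exact: locq.
  - rewrite PV -Va /=; case: n ih nN {szP PV PV' locP Va Vb rE} => [|n] ih nN.
      by rewrite t0 V0 P0 hornerD hornerC hornerZ hornerX mulr0 addr0.
    have nN' : (1 <= n.+1 <= N)%N by rewrite /= ltnW.
    by have [_ ->] := Vends n.+1 nN'; rewrite ih.
  (* The slope at the left node comes from the one-sided quotient at 0 on the first subinterval, and
     from [Sobolev2_no_jump] at later nodes. *)
  - rewrite PV' /=; case: n ih nN {szP PV PV' locP Vb rE} Va => [|n] ih nN Va.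
      rewrite t0 P0 derivD derivC add0r derivZ derivX hornerZ hornerC mulr1.
      have t1 : 0 < t 1%N by rewrite -t0 (t_incr 1%N).
      apply: (right_quotient_piece V (q 1%N) (t 1%N)) => //.
        by move: Va; rewrite /= t0.
      by move=> x x01; apply: Vq => //=; rewrite t0.
    have nN' : (1 <= n.+1 <= N)%N by rewrite /= ltnW.
    rewrite -ih//; symmetry.
    have [Vc Vd] := Vends n.+1 nN'.
    apply: (Sobolev2_no_jump T (t n) (t n.+1) (t n.+2) V) => //.
    + exact: (tpred_ge0 n.+1).
    + exact: (t_incr n.+1).
    + exact: (t_incr n.+2).
    + exact: t_leT'.
    + by rewrite -Vd Va.
    move=> x /andP[x1 x2]; rewrite /glue; case: (ltgtP x (t n.+1)) => [xl|xr|->].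
    + by rewrite (Vq n.+1)//= x1.
    + by rewrite (Vq n.+2)//= x2 xr.
    + by rewrite Vd.
(* The point 0 lies in none of the half-open intervals [(t n.-1, t n]] and is treated through the
   initial value. *)
move=> s /andP[s0 sT]; have [{}s0|] := ltP 0 s; last first.
  move=> s0'; have -> : s = 0 by apply/eqP; rewrite eq_le s0 s0'.
  by rewrite V0 (pw_le0 t N t_incr) ?t0// P0 hornerD hornerC hornerZ hornerX mulr0 addr0.
have [|n nN sn] := nodes_locate s; first by rewrite s0.
rewrite (pwE t N t_incr _ n)// -(qP n nN).
move: sn => /andP[s1]; rewrite le_eqVlt => /predU1P[->|s2].
  by have [] := Vends n nN.
by rewrite (Vq n)// s1.
Qed.

End discrete_problem.

Theorem lemma1 (R : realType) (T : R) (u0 u1 : R) (f : R -> R -> R -> R)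
    (L : R) (N : nat) (t : nat -> R) (r : nat -> nat)
    (hT : 0 < T)
    (hfcont : forall u v : R, {within `[0, T], continuous (fun s => f s u v)})
    (hL : 0 < L)
    (hfLip : forall s w1 v1 w2 v2 : R, 0 <= s <= T ->
       `|f s w1 v1 - f s w2 v2| <= L * (`|w1 - w2| + `|v1 - v2|))
    (hpart : is_partition T N t)
    (hr : forall n : nat, (1 <= n <= N)%N -> (2 <= r n)%N)
    (hstep : forall n : nat, (1 <= n <= N)%N ->
       L * step t n / 2 * Num.sqrt (8 + step t n ^+ 2) < 1) :
  exists U : R -> R,
    discrete_solution T N t r f u0 u1 U /\
    forall V : R -> R, discrete_solution T N t r f u0 u1 V ->
      forall s : R, 0 <= s <= T -> V s = U s.
Proof.
have [P [P0 HP]] :=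
  galerkin_sequence T u0 u1 f L N t r hT hfcont hL hfLip hpart hr hstep.
exists (pw t P N); split.
  exact: (discrete_solution_pw T u0 u1 f L N t r hT hfcont hL hfLip hpart hr).
move=> V dV s sT.
exact: (discrete_solution_unique T u0 u1 f L N t r hT hfcont hL hfLip hpart hr
  hstep P V P0 HP dV s sT).
Qed.
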